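(* Let $Y$ be a finite set of symbols, $X \subseteq Y$, and $F$ a ground (quantifier-free) $\sigma_{or}(Y)$-formula. The procedure $\mathtt{consequence}(F,X)$ described below terminates and returns a pair $\langle Z,P\rangle$, reduced with respect to the base monomial ordering $\preceq$, such that $\mathrm{alg.cone}_X(Z,P) = \mathrm{Cn}_X(F)$. Procedure: set $G := F$ and $\langle Z,P\rangle := \langle\{1\},\{0\}\rangle$. While $G$ is satisfiable modulo $\mathbf{LRR}$: let $\langle Z',P'\rangle := \mathtt{get\text{-}model}(G)$; set $\langle Z',P'\rangle := \mathit{project}_X(Z',P')$; set $\langle Z,P\rangle := \mathit{intersect}(Z,P,Z',P')$; set $G := G\land\lnot\big(\bigwedge_{z\in Z} z = 0 \land \bigwedge_{p\in P} 0\le p\big)$. When $G$ is unsatisfiable, return $\langle Z,P\rangle$.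
   Context: $\sigma_{or}$ has $+,\cdot,0,1,=,\le$; $\sigma_{or}(Y)$ adds $Y$ as constants; rational-coefficient atoms abbreviate $\sigma_{or}(Y)$-atoms. $\mathbf{LRR}$ is the $\sigma_{or}$-theory axiomatized by: the commutative ring axioms; reflexivity, transitivity, antisymmetry of $\le$; $\forall x,y,z\,(x\le y\Rightarrow x+z\le y+z)$; $0\le1\land0\ne1$; for each integer $n\ge1$, $\exists x\,(x+\dots+x=1)$; for each integer $n\ge1$, $\forall x\,(0\le x+\dots+x\Rightarrow0\le x)$ ($n$ summands). $\mathrm{Cn}_X(F)=\{p\in\mathbb{Q}[X]: F\models_{\mathbf{LRR}}0\le p\}$. A cone contains $0$ and is closed under addition and non-negative rational scaling; regular if it contains $1$ and its additive units $\{p:p,-p\in C\}$ form an ideal. $\mathrm{alg.cone}_V(Z,P)=\langle Z\rangle_V+\mathrm{cone}(P)$ (ideal of $\mathbb{Q}[V]$ generated by $Z$ plus non-negative rational combinations of $P$). $\langle Z,P\rangle$ is reduced w.r.t. $\preceq$ if $Z$ is a Gröbner basis of $\langle Z\rangle$ and each $p\in P$ is its own normal form modulo $Z$. $\mathtt{get\text{-}model}(G)$: writing each atom as $0\le p$ or $0=p$ (the latter contributing both $0\le p$ and $0\le -p$), it selects a cube $G_i$ (conjunction of literals) of a disjunctive normal form of $G$ that is satisfiable modulo $\mathbf{LRR}$, and returns a reduced pair whose algebraic cone is the least regular cone in $\mathbb{Q}[Y]$ containing the polynomials of the non-negated atoms of $G_i$. $\mathit{project}_X(Z,P)=\langle G\cap\mathbb{Q}[X],\mathrm{proj}(\{\mathbf{red}_G(p):p\in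 P\},[X])\rangle$, with $G$ a Gröbner basis of the ideal generated by $Z$ w.r.t. the elimination ordering $\preceq_X$ (monomials $m_Xm_{\overline X}$ compared first by their part over $Y\setminus X$, then by their part over $X$, using $\preceq$), $[X]$ the monomials over $X$, and $\mathrm{proj}(S,N)$ a finite set with $\mathrm{cone}(\mathrm{proj}(S,N))=\mathrm{cone}(S)\cap\mathrm{span}_{\mathbb{Q}}(N)$ (Fourier–Motzkin). $\mathit{intersect}(Z_1,P_1,Z_2,P_2)=\mathit{project}_X(tZ_1\cup(1-t)Z_2,tP_1\cup(1-t)P_2)$ for a fresh variable $t$, with $fS=\{fs:s\in S\}$.
   Formalization: In get-model, the disjunctive normal form of G must be built only from literals (with their polarity) of the negation normal form of G; with arbitrary disjunctive normal forms, which may add irrelevant positive atoms, the loop need not terminate. *)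

(* Defs.v *)
From HB Require Import structures.
From mathcomp Require Import all_boot all_order all_algebra.
From mathcomp.multinomials Require Import mpoly.
From Stdlib Require List Relation_Operators.

Set Implicit Arguments.
Unset Strict Implicit.
Unset Printing Implicit Defensive.

Import Order.TTheory GRing.Theory Num.Theory.
Local Open Scope ring_scope.

(* All symbols live in the ambient finite set 'I_n.  For W : {set 'I_n}, the
   ring Q[W] is the set of the p : {mpoly rat[n]} whose monomials only involve
   variables of W (poly_over W), and sigma_or(W) only uses constants in W. *)

(** * Ground formulas over sigma_or(Y) *)

Inductive term (n : nat) : Type :=
| TConst (i : 'I_n)
| TZero
| TOne
| TAdd (s u : term n)
| TMul (s u : term n).
Arguments TZero {n}.
Arguments TOne {n}.

Inductive atom (n : nat) : Type :=
| ALe (s u : term n)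
| AEq (s u : term n).

(* Falsity, implication and equivalence are the usual abbreviations. *)
Inductive formula (n : nat) : Type :=
| FTrue
| FAtom (a : atom n)
| FNot (f : formula n)
| FAnd (f g : formula n)
| FOr (f g : formula n).
Arguments FTrue {n}.

Fixpoint tconsts (n : nat) (s : term n) : seq 'I_n :=
  match s with
  | TConst i => [:: i]
  | TZero | TOne => [::]
  | TAdd s u | TMul s u => tconsts s ++ tconsts u
  end.

Definition aconsts (n : nat) (a : atom n) : seq 'I_n :=
  match a with ALe s u | AEq s u => tconsts s ++ tconsts u end.

Fixpoint fconsts (n : nat) (f : formula n) : seq 'I_n :=
  match f with
  | FTrue => [::]
  | FAtom a => aconsts a
  | FNot f => fconsts f
  | FAnd f g | FOr f g => fconsts f ++ fconsts g
  end.

Definition formula_over (n : nat) (Y : {set 'I_n}) (f : formula n) : Prop :=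
  {subset fconsts f <= Y}.

(** * Semantics modulo LRR *)

(* The commutative ring axioms and 0 <> 1 are those of comNzRingType. *)
Record LRR (R : comNzRingType) (le : R -> R -> Prop) : Prop := {
  LRR_refl : forall x, le x x;
  LRR_trans : forall x y z, le x y -> le y z -> le x z;
  LRR_antisym : forall x y, le x y -> le y x -> x = y;
  LRR_add : forall x y z, le x y -> le (x + z) (y + z);
  LRR_le01 : le 0 1;
  LRR_div : forall k : nat, (1 <= k)%N -> exists x : R, x *+ k = 1;
  LRR_unperforated :
    forall k : nat, (1 <= k)%N -> forall x : R, le 0 (x *+ k) -> le 0 x
}.

Fixpoint tval (n : nat) (R : comNzRingType) (v : 'I_n -> R) (s : term n) : R :=
  match s with
  | TConst i => v i
  | TZero => 0
  | TOne => 1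
  | TAdd s u => tval v s + tval v u
  | TMul s u => tval v s * tval v u
  end.

Definition atom_holds (n : nat) (R : comNzRingType) (le : R -> R -> Prop)
    (v : 'I_n -> R) (a : atom n) : Prop :=
  match a with
  | ALe s u => le (tval v s) (tval v u)
  | AEq s u => tval v s = tval v u
  end.

Fixpoint prop_eval (n : nat) (h : atom n -> Prop) (f : formula n) : Prop :=
  match f with
  | FTrue => True
  | FAtom a => h a
  | FNot f => ~ prop_eval h f
  | FAnd f g => prop_eval h f /\ prop_eval h g
  | FOr f g => prop_eval h f \/ prop_eval h g
  end.

Definition holds (n : nat) (R : comNzRingType) (le : R -> R -> Prop)
    (v : 'I_n -> R) (f : formula n) : Prop :=
  prop_eval (atom_holds le v) f.

Definition satisfiable (n : nat) (f : formula n) : Prop :=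
  exists (R : comNzRingType) (le : R -> R -> Prop) (v : 'I_n -> R),
    LRR le /\ holds le v f.

Definition entails (n : nat) (f g : formula n) : Prop :=
  forall (R : comNzRingType) (le : R -> R -> Prop) (v : 'I_n -> R),
    LRR le -> holds le v f -> holds le v g.

(** * Atoms with rational coefficients as abbreviations of sigma_or-atoms *)

Definition term_nat (n k : nat) : term n := iter k (TAdd TOne) TZero.

Definition term_mon (n : nat) (m : 'X_{1..n}) : term n :=
  foldr (fun i s => iter (m i) (TMul (TConst i)) s) TOne (enum 'I_n).

Definition common_den (n : nat) (p : {mpoly rat[n]}) : int :=
  \prod_(m <- msupp p) denq p@_m.

(* The positive and negative parts of (common_den p) * p, which have natural
   number coefficients; 0 <= p stands for  term_neg p <= term_pos p. *)
Definition term_part (n : nat) (p : {mpoly rat[n]}) (s : seq 'X_{1..n})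
    : term n :=
  foldr (@TAdd n) TZero
    [seq TMul (term_nat n (absz (numq ((common_den p)%:~R * p@_m))))
              (term_mon m) | m <- s].

Definition term_pos (n : nat) (p : {mpoly rat[n]}) : term n :=
  term_part p [seq m <- msupp p | 0 < p@_m].

Definition term_neg (n : nat) (p : {mpoly rat[n]}) : term n :=
  term_part p [seq m <- msupp p | p@_m < 0].

Definition FLe0 (n : nat) (p : {mpoly rat[n]}) : formula n :=
  FAtom (ALe (term_neg p) (term_pos p)).

Definition FEq0 (n : nat) (p : {mpoly rat[n]}) : formula n :=
  FAtom (AEq (term_neg p) (term_pos p)).

(** * Q[W], ideals and cones *)

Definition mon_over (n : nat) (W : {set 'I_n}) : pred 'X_{1..n} :=
  fun m => [forall i, (i \notin W) ==> (m i == 0%N)].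

Definition in_span (n : nat) (N : pred 'X_{1..n}) (p : {mpoly rat[n]}) : bool :=
  all N (msupp p).

Definition poly_over (n : nat) (W : {set 'I_n}) (p : {mpoly rat[n]}) : bool :=
  in_span (mon_over W) p.

Definition ideal_gen (n : nat) (W : {set 'I_n}) (Z : seq {mpoly rat[n]})
    (p : {mpoly rat[n]}) : Prop :=
  exists q : 'I_(size Z) -> {mpoly rat[n]},
    (forall i, poly_over W (q i)) /\ p = \sum_(i < size Z) q i * Z`_i.

Definition cone_gen (n : nat) (P : seq {mpoly rat[n]}) (p : {mpoly rat[n]})
    : Prop :=
  exists c : 'I_(size P) -> rat,
    (forall i, 0 <= c i) /\ p = \sum_(i < size P) c i *: P`_i.

(* A pair <Z, P> of finite sets, represented by lists. *)
Definition zp_pair (n : nat) : Type :=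
  (seq {mpoly rat[n]} * seq {mpoly rat[n]})%type.

Definition alg_cone (n : nat) (W : {set 'I_n}) (ZP : zp_pair n)
    (p : {mpoly rat[n]}) : Prop :=
  exists a b, [/\ ideal_gen W ZP.1 a, cone_gen ZP.2 b & p = a + b].

Definition Cn (n : nat) (X : {set 'I_n}) (f : formula n) (p : {mpoly rat[n]})
    : Prop :=
  poly_over X p /\ entails f (FLe0 p).

Definition is_ideal (n : nat) (W : {set 'I_n}) (I : {mpoly rat[n]} -> Prop)
    : Prop :=
  [/\ forall p, I p -> poly_over W p,
      I 0,
      forall p q, I p -> I q -> I (p + q)
    & forall p q, poly_over W p -> I q -> I (p * q)].

Definition is_cone (n : nat) (W : {set 'I_n}) (C : {mpoly rat[n]} -> Prop)
    : Prop :=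
  [/\ forall p, C p -> poly_over W p,
      C 0,
      forall p q, C p -> C q -> C (p + q)
    & forall (c : rat) p, 0 <= c -> C p -> C (c *: p)].

Definition regular_cone (n : nat) (W : {set 'I_n}) (C : {mpoly rat[n]} -> Prop)
    : Prop :=
  [/\ is_cone W C, C 1 & is_ideal W (fun p => C p /\ C (- p))].

Definition least_regular_cone (n : nat) (W : {set 'I_n})
    (S : seq {mpoly rat[n]}) (C : {mpoly rat[n]} -> Prop) : Prop :=
  [/\ regular_cone W C,
      forall p, p \in S -> C p
    & forall C', regular_cone W C' -> (forall p, p \in S -> C' p) ->
        forall p, C p -> C' p].

(** * Monomial orderings, Groebner bases, reduced pairs *)

Record monomial_order (n : nat) (le : rel 'X_{1..n}) : Prop := {
  mo_refl : reflexive le;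
  mo_antisym : antisymmetric le;
  mo_trans : transitive le;
  mo_total : total le;
  mo_one : forall m, le 0%MM m;
  mo_mul : forall m1 m2 m : 'X_{1..n}, le m1 m2 -> le (m1 + m)%MM (m2 + m)%MM
}.

Definition mon_part (n : nat) (W : {set 'I_n}) (m : 'X_{1..n}) : 'X_{1..n} :=
  [multinom (if i \in W then m i else 0%N) | i < n].

(* The elimination ordering; on monomials over a set V of variables, the part
   over ~: X is the part over V :\: X. *)
Definition elim_order (n : nat) (le : rel 'X_{1..n}) (X : {set 'I_n})
    : rel 'X_{1..n} :=
  fun m1 m2 =>
    if mon_part (~: X) m1 == mon_part (~: X) m2
    then le (mon_part X m1) (mon_part X m2)
    else le (mon_part (~: X) m1) (mon_part (~: X) m2).

(* The zero polynomial has no leading monomial. *)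
Definition lead_mon (n : nat) (le : rel 'X_{1..n}) (p : {mpoly rat[n]})
    (m : 'X_{1..n}) : Prop :=
  m \in msupp p /\ forall m', m' \in msupp p -> le m' m.

(* G is a Groebner basis of the ideal of Q[W] generated by Z. *)
Definition groebner (n : nat) (le : rel 'X_{1..n}) (W : {set 'I_n})
    (G Z : seq {mpoly rat[n]}) : Prop :=
  (forall p, ideal_gen W G p <-> ideal_gen W Z p) /\
  (forall p m, ideal_gen W Z p -> lead_mon le p m ->
     exists g m', [/\ g \in G, lead_mon le g m' & (m' <= m)%MM]).

(* When G is a Groebner basis, r is unique: it is red_G(p). *)
Definition normal_form (n : nat) (le : rel 'X_{1..n}) (W : {set 'I_n})
    (G : seq {mpoly rat[n]}) (p r : {mpoly rat[n]}) : Prop :=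
  ideal_gen W G (p - r) /\
  (forall m g m', m \in msupp r -> g \in G -> lead_mon le g m' ->
     ~~ (m' <= m)%MM).

Definition reduced (n : nat) (le : rel 'X_{1..n}) (W : {set 'I_n})
    (ZP : zp_pair n) : Prop :=
  groebner le W ZP.1 ZP.1 /\
  (forall p, p \in ZP.2 -> normal_form le W ZP.1 p p).

(** * The sub-procedures, as relations between arguments and results *)

(* (true, a) is the literal a and (false, a) is its negation. *)
Definition literal (n : nat) : Type := (bool * atom n)%type.
Definition cube (n : nat) : Type := seq (literal n).

Definition literal_formula (n : nat) (l : literal n) : formula n :=
  if l.1 then FAtom l.2 else FNot (FAtom l.2).

Definition cube_formula (n : nat) (c : cube n) : formula n :=
  foldr (fun l f => FAnd (literal_formula l) f) FTrue c.

(* The literals of the negation normal form of f (b = true) or ~ f (b = false). *)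
Fixpoint nnf_literals (n : nat) (b : bool) (f : formula n) : seq (literal n) :=
  match f with
  | FTrue => [::]
  | FAtom a => [:: (b, a)]
  | FNot f => nnf_literals (~~ b) f
  | FAnd f g | FOr f g => nnf_literals b f ++ nnf_literals b g
  end.

(* D is a disjunctive normal form of f: a disjunction of cubes that is
   propositionally equivalent to f and built, as in the usual conversion, from
   the literals of the negation normal form of f.  (Without the latter, cubes
   could contain irrelevant positive atoms.) *)
Definition is_dnf (n : nat) (D : seq (cube n)) (f : formula n) : Prop :=
  (forall c l, List.In c D -> List.In l c -> List.In l (nnf_literals true f)) /\
  (forall h : atom n -> Prop,
     prop_eval h f <-> exists c, List.In c D /\ prop_eval h (cube_formula c)).

Definition term_poly (n : nat) (s : term n) : {mpoly rat[n]} :=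
  tval (fun i : 'I_n => 'X_i : {mpoly rat[n]}) s.

Definition literal_polys (n : nat) (l : literal n) : seq {mpoly rat[n]} :=
  match l with
  | (true, ALe s u) => [:: term_poly u - term_poly s]
  | (true, AEq s u) =>
      [:: term_poly u - term_poly s; - (term_poly u - term_poly s)]
  | (false, _) => [::]
  end.

Definition cube_polys (n : nat) (c : cube n) : seq {mpoly rat[n]} :=
  flatten [seq literal_polys l | l <- c].

Definition get_model (n : nat) (le : rel 'X_{1..n}) (Y : {set 'I_n})
    (G : formula n) (ZP : zp_pair n) : Prop :=
  exists (D : seq (cube n)) (c : cube n),
    [/\ is_dnf D G,
        List.In c D,
        satisfiable (cube_formula c),
        reduced le Y ZP
      & least_regular_cone Y (cube_polys c) (alg_cone Y ZP)].

(* P is a possible value of proj(S, N). *)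
Definition is_proj (n : nat) (S : seq {mpoly rat[n]}) (N : pred 'X_{1..n})
    (P : seq {mpoly rat[n]}) : Prop :=
  forall p, cone_gen P p <-> cone_gen S p /\ in_span N p.

(* project_X on pairs of finite subsets of Q[V]. *)
Definition project (n : nat) (le : rel 'X_{1..n}) (V X : {set 'I_n})
    (ZP ZP' : zp_pair n) : Prop :=
  exists G S : seq {mpoly rat[n]},
    [/\ groebner (elim_order le X) V G ZP.1,
        forall s, s \in S <->
          exists2 p, p \in ZP.2 & normal_form (elim_order le X) V G p s,
        ZP'.1 = [seq g <- G | poly_over X g]
      & is_proj S (mon_over X) ZP'.2].

Definition scale_seq (n : nat) (f : {mpoly rat[n]}) (S : seq {mpoly rat[n]})
    : seq {mpoly rat[n]} :=
  [seq f * s | s <- S].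

Definition intersect (n : nat) (le : rel 'X_{1..n}) (X : {set 'I_n}) (t : 'I_n)
    (ZP1 ZP2 ZP' : zp_pair n) : Prop :=
  project le (t |: X) X
    (scale_seq 'X_t ZP1.1 ++ scale_seq (1 - 'X_t) ZP2.1,
     scale_seq 'X_t ZP1.2 ++ scale_seq (1 - 'X_t) ZP2.2) ZP'.

(** * The procedure consequence(F, X) *)

Definition zp_formula (n : nat) (ZP : zp_pair n) : formula n :=
  FAnd (foldr (fun z f => FAnd (FEq0 z) f) FTrue ZP.1)
       (foldr (fun p f => FAnd (FLe0 p) f) FTrue ZP.2).

(* Control points, with the values of the live variables: the loop test, before
   the call to project, before the call to intersect, and after the return. *)
Inductive config (n : nat) : Type :=
| AtTest (G : formula n) (ZP : zp_pair n)
| AtProject (G : formula n) (ZP ZP' : zp_pair n)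
| AtIntersect (G : formula n) (ZP ZP' : zp_pair n)
| Returned (ZP : zp_pair n).

Inductive step (n : nat) (le : rel 'X_{1..n}) (Y X : {set 'I_n}) (t : 'I_n)
    : config n -> config n -> Prop :=
| step_get_model G ZP ZP' :
    satisfiable G -> get_model le Y G ZP' ->
    step le Y X t (AtTest G ZP) (AtProject G ZP ZP')
| step_project G ZP ZP' ZP'' :
    project le Y X ZP' ZP'' ->
    step le Y X t (AtProject G ZP ZP') (AtIntersect G ZP ZP'')
| step_intersect G ZP ZP' ZP'' :
    intersect le X t ZP ZP' ZP'' ->
    step le Y X t (AtIntersect G ZP ZP')
                  (AtTest (FAnd G (FNot (zp_formula ZP''))) ZP'')
| step_return G ZP :
    ~ satisfiable G ->
    step le Y X t (AtTest G ZP) (Returned ZP).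

Definition initial (n : nat) (F : formula n) : config n :=
  AtTest F ([:: 1], [:: 0]).

Definition reachable (n : nat) (le : rel 'X_{1..n}) (Y X : {set 'I_n})
    (t : 'I_n) (F : formula n) (c : config n) : Prop :=
  Relation_Operators.clos_refl_trans _ (step le Y X t) (initial F) c.

(* Every execution is finite, and one that cannot be continued has returned. *)
Definition consequence_terminates (n : nat) (le : rel 'X_{1..n})
    (Y X : {set 'I_n}) (t : 'I_n) (F : formula n) : Prop :=
  Acc (fun c' c => step le Y X t c c') (initial F) /\
  forall c, reachable le Y X t F c ->
    (exists c', step le Y X t c c') \/ (exists ZP, c = Returned ZP).

Definition consequence_returns (n : nat) (le : rel 'X_{1..n})
    (Y X : {set 'I_n}) (t : 'I_n) (F : formula n) (ZP : zp_pair n) : Prop :=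
  reachable le Y X t F (Returned ZP).

(* Main.v *)
Require Import Defs.
From HB Require Import structures.
From mathcomp Require Import all_boot all_order all_algebra ring.
From mathcomp.multinomials Require Import mpoly.
From Stdlib Require Import Classical ClassicalEpsilon.
From Stdlib Require List.

Set Implicit Arguments.
Unset Strict Implicit.
Unset Printing Implicit Defensive.

Import Order.TTheory GRing.Theory Num.Theory.
Local Open Scope ring_scope.

(** The loop enumerates cubes [c] of a disjunctive normal form of [G].  The
   polynomials that are non-negative at a model of LRR form a regular cone, and
   conversely [Q[Y]] modulo the additive units of a regular cone [C] not
   containing [-1], ordered by [C], is a model of LRR.  When [c] is satisfiable
   and [C] is the least regular cone containing its positive atoms, this model
   satisfies [c], negated atoms included, because [C] is below the cone of any
   model of [c].  So [C] consists exactly of the consequences of [c], and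
   projecting to [Q[X]] and intersecting over the cubes yields the
   consequences of [F].

   Projection is correct because the normal form of a polynomial of [Q[X]]
   modulo a Groebner basis for the elimination ordering only uses the basis
   elements in [Q[X]]; intersection is correct by specializing [t] to 1 and 0.

   The negated conjunctions added to [G] contribute no positive atom, so each
   cone computed from a cube is determined by a subset of the positive atoms of
   [F]; each iteration excludes one of these finitely many subsets. *)

(** * Polynomials, ideals and cones *)

Section PolyOver.
Variables (n : nat).
Implicit Types (W : {set 'I_n}) (p q : {mpoly rat[n]}) (m : 'X_{1..n}).

Lemma mon_overP W m :
  reflect (forall i, i \notin W -> m i = 0%N) (mon_over W m).
Proof.
apply: (iffP forallP) => [h i iW|h i]; first by have /implyP/(_ iW)/eqP := h i.
by apply/implyP => /h ->.
Qed.

Lemma mon_over_le W m m' : (m' <= m)%MM -> mon_over W m -> mon_over W m'.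
Proof.
move=> /mnm_lepP le_m /mon_overP h; apply/mon_overP => i /h mi.
by apply/eqP; rewrite -leqn0 -mi.
Qed.

Lemma mon_over_add W m m' :
  mon_over W m -> mon_over W m' -> mon_over W (m + m')%MM.
Proof.
move=> /mon_overP h /mon_overP h'; apply/mon_overP => i iW.
by rewrite mnmDE h // h'.
Qed.

Lemma mon_overS W W' m : W \subset W' -> mon_over W m -> mon_over W' m.
Proof.
move=> /subsetP sW /mon_overP h; apply/mon_overP => i iW'.
by apply: h; apply: contra iW' => /sW.
Qed.

Lemma poly_overP W p :
  reflect (forall m, m \in msupp p -> mon_over W m) (poly_over W p).
Proof. exact: allP. Qed.

Lemma poly_over0 W : poly_over W 0.
Proof. by apply/poly_overP => m; rewrite -mpolyC0 msupp0. Qed.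

Lemma poly_overX W m : mon_over W m -> poly_over W 'X_[m].
Proof. by move=> h; apply/poly_overP => m'; rewrite msuppX inE => /eqP ->. Qed.

Lemma poly_overXU W i : i \in W -> poly_over W 'X_i.
Proof.
move=> iW; apply: poly_overX; apply/mon_overP => j jW.
by rewrite mnm1E; case: eqVneq jW => // <-; rewrite iW.
Qed.

Lemma poly_over1 W : poly_over W 1.
Proof. by rewrite -mpolyX0; apply/poly_overX/mon_overP => i _; rewrite mnm0E. Qed.

Lemma poly_overD W p q : poly_over W p -> poly_over W q -> poly_over W (p + q).
Proof.
move=> /poly_overP hp /poly_overP hq; apply/poly_overP => m /msuppD_le.
by rewrite mem_cat => /orP[/hp|/hq].
Qed.

Lemma poly_overZ W c p : poly_over W p -> poly_over W (c *: p).
Proof. by move=> /poly_overP hp; apply/poly_overP => m /msuppZ_le /hp. Qed.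

Lemma poly_overN W p : poly_over W p -> poly_over W (- p).
Proof. by rewrite -scaleN1r; apply: poly_overZ. Qed.

Lemma poly_overB W p q : poly_over W p -> poly_over W q -> poly_over W (p - q).
Proof. by move=> hp hq; apply/poly_overD/poly_overN. Qed.

Lemma poly_overM W p q : poly_over W p -> poly_over W q -> poly_over W (p * q).
Proof.
move=> /poly_overP hp /poly_overP hq; apply/poly_overP => m /msuppM_le.
by case/allpairsP => -[m1 m2] /= [/hp h1 /hq h2 ->]; apply: mon_over_add.
Qed.

Lemma poly_over_sum W (I : Type) (r : seq I) (P : pred I)
    (F : I -> {mpoly rat[n]}) :
  (forall i, P i -> poly_over W (F i)) -> poly_over W (\sum_(i <- r | P i) F i).
Proof.
move=> h; apply: (big_ind (poly_over W)) => //; [exact: poly_over0|exact: poly_overD].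
Qed.

Lemma poly_overT p : poly_over setT p.
Proof.
by apply/poly_overP => m _; apply/mon_overP => i; rewrite inE.
Qed.

Lemma poly_overS W W' p : W \subset W' -> poly_over W p -> poly_over W' p.
Proof.
by move=> sW /poly_overP h; apply/poly_overP => m /h; apply: mon_overS.
Qed.

(** Serves both to specialize the fresh variable [t] and to kill the variables outside [Y]. *)
Definition psubst (h : 'I_n -> {mpoly rat[n]}) (p : {mpoly rat[n]}) :=
  mmap (@mpolyC n rat) h p.

Lemma psubst_over W W' h p :
  (forall i, i \in W -> poly_over W' (h i)) -> poly_over W p ->
  poly_over W' (psubst h p).
Proof.
move=> hh /poly_overP hp; rewrite /psubst /mmap big_seq.
apply: poly_over_sum => m /hp /mon_overP hm.
rewrite mul_mpolyC; apply: poly_overZ; rewrite /mmap1.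
apply: (big_ind (poly_over W')); [exact: poly_over1|exact: poly_overM|move=> i _].
have [iW|/hm ->] := boolP (i \in W); last by rewrite expr0 poly_over1.
elim: (m i) => [|k IH]; first by rewrite expr0 poly_over1.
by rewrite exprS; apply: poly_overM => //; apply: hh.
Qed.

Lemma psubst_id W h p :
  (forall i, i \in W -> h i = 'X_i) -> poly_over W p -> psubst h p = p.
Proof.
move=> hh /poly_overP hp; rewrite /psubst /mmap [RHS]mpolyE.
apply: eq_big_seq => m /hp /mon_overP hm; rewrite mul_mpolyC; congr (_ *: _).
rewrite mpolyXE_id /mmap1; apply: eq_bigr => i _.
by have [/hh ->|/hm ->] := boolP (i \in W); rewrite ?expr0.
Qed.

Lemma psubstXU h i : psubst h 'X_i = h i.
Proof. by rewrite /psubst mmapX mmap1U. Qed.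

Lemma psubstZ h c p : psubst h (c *: p) = c *: psubst h p.
Proof. by rewrite -mul_mpolyC /psubst rmorphM /= mmapC mul_mpolyC. Qed.

End PolyOver.

(** * Generated ideals and cones, Fourier-Motzkin elimination *)

Section IdealsCones.
Variables (n : nat).
Implicit Types (W : {set 'I_n}) (p q : {mpoly rat[n]}).
Implicit Types (Z P S : seq {mpoly rat[n]}) (ZP : zp_pair n).

Lemma ideal_gen0 W Z : ideal_gen W Z 0.
Proof.
exists (fun _ => 0); split => [i|]; first exact: poly_over0.
by rewrite big1 // => i _; rewrite mul0r.
Qed.

Lemma ideal_genD W Z p q :
  ideal_gen W Z p -> ideal_gen W Z q -> ideal_gen W Z (p + q).
Proof.
move=> [a [ha ->]] [b [hb ->]]; exists (fun i => a i + b i).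
split => [i|]; first exact: poly_overD.
by rewrite -big_split; apply: eq_bigr => i _; rewrite mulrDl.
Qed.

Lemma ideal_genM W Z p q :
  poly_over W p -> ideal_gen W Z q -> ideal_gen W Z (p * q).
Proof.
move=> hp [a [ha ->]]; exists (fun i => p * a i).
split => [i|]; first exact: poly_overM.
by rewrite mulr_sumr; apply: eq_bigr => i _; rewrite mulrA.
Qed.

Lemma ideal_genZ W Z c q : ideal_gen W Z q -> ideal_gen W Z (c *: q).
Proof.
rewrite -mul_mpolyC; apply: ideal_genM.
by rewrite -alg_mpolyC; apply/poly_overZ/poly_over1.
Qed.

Lemma ideal_genN W Z q : ideal_gen W Z q -> ideal_gen W Z (- q).
Proof. by rewrite -scaleN1r; apply: ideal_genZ. Qed.

Lemma ideal_genB W Z p q :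
  ideal_gen W Z p -> ideal_gen W Z q -> ideal_gen W Z (p - q).
Proof. by move=> hp hq; apply/ideal_genD/ideal_genN. Qed.

Lemma ideal_gen_mem W Z z : z \in Z -> ideal_gen W Z z.
Proof.
move=> zZ; have lt_z : (index z Z < size Z)%N by rewrite index_mem.
exists (fun i => if i == Ordinal lt_z then 1 else 0); split => [i|].
  by case: ifP => _; rewrite ?poly_over0 ?poly_over1.
rewrite (bigD1 (Ordinal lt_z)) //= eqxx mul1r nth_index // big1 ?addr0 //.
by move=> i /negbTE ->; rewrite mul0r.
Qed.

Lemma ideal_gen_ind W Z (I : {mpoly rat[n]} -> Prop) :
  I 0 -> (forall p q, I p -> I q -> I (p + q)) ->
  (forall p z, poly_over W p -> z \in Z -> I (p * z)) ->
  forall p, ideal_gen W Z p -> I p.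
Proof.
move=> I0 ID IM p [a [ha ->]]; apply: (big_ind _) => // i _.
by apply: IM => //; apply: mem_nth.
Qed.

Lemma ideal_gen_over W Z :
  (forall z, z \in Z -> poly_over W z) ->
  forall p, ideal_gen W Z p -> poly_over W p.
Proof.
move=> hZ; apply: ideal_gen_ind; [exact: poly_over0|exact: poly_overD|].
by move=> p z hp /hZ; apply: poly_overM.
Qed.

Lemma ideal_gen_sub W W' Z Z' :
  W \subset W' -> (forall z, z \in Z -> ideal_gen W' Z' z) ->
  forall p, ideal_gen W Z p -> ideal_gen W' Z' p.
Proof.
move=> sW hZ; apply: ideal_gen_ind; [exact: ideal_gen0|exact: ideal_genD|].
by move=> p z hp /hZ; apply: ideal_genM; apply: poly_overS hp.
Qed.

Lemma cone_gen0 P : cone_gen P 0.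
Proof.
exists (fun _ => 0); split => // ; by rewrite big1 // => i _; rewrite scale0r.
Qed.

Lemma cone_genD P p q : cone_gen P p -> cone_gen P q -> cone_gen P (p + q).
Proof.
move=> [a [ha ->]] [b [hb ->]]; exists (fun i => a i + b i).
split => [i|]; first exact: addr_ge0.
by rewrite -big_split; apply: eq_bigr => i _; rewrite scalerDl.
Qed.

Lemma cone_genZ P c p : 0 <= c -> cone_gen P p -> cone_gen P (c *: p).
Proof.
move=> hc [a [ha ->]]; exists (fun i => c * a i).
split => [i|]; first exact: mulr_ge0.
by rewrite scaler_sumr; apply: eq_bigr => i _; rewrite scalerA.
Qed.

Lemma cone_gen_mem P p : p \in P -> cone_gen P p.
Proof.
move=> pP; have lt_p : (index p P < size P)%N by rewrite index_mem.
exists (fun i => if i == Ordinal lt_p then 1 else 0); split => [i|].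
  by case: ifP.
rewrite (bigD1 (Ordinal lt_p)) //= eqxx scale1r nth_index // big1 ?addr0 //.
by move=> i /negbTE ->; rewrite scale0r.
Qed.

Lemma cone_gen_ind P (C : {mpoly rat[n]} -> Prop) :
  C 0 -> (forall p q, C p -> C q -> C (p + q)) ->
  (forall c p, 0 <= c -> p \in P -> C (c *: p)) ->
  forall p, cone_gen P p -> C p.
Proof.
move=> C0 CD CZ p [a [ha ->]]; apply: (big_ind _) => // i _.
by apply: CZ => //; apply: mem_nth.
Qed.

(** [N] is arbitrary because two instances are used: the monomials over a set of variables, and the
    monomials not divisible by a given leading monomial. The second shows that a cone generated by
    irreducible polynomials contains only irreducible ones. *)
Lemma cone_gen_supp P (N : pred 'X_{1..n}) :
  (forall p, p \in P -> in_span N p) ->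
  forall p, cone_gen P p -> in_span N p.
Proof.
move=> hP; apply: cone_gen_ind.
- by rewrite /in_span -mpolyC0 msupp0.
- move=> p q /allP hp /allP hq; apply/allP => m /msuppD_le.
  by rewrite mem_cat => /orP[/hp|/hq].
- by move=> c p _ /hP /allP hp; apply/allP => m /msuppZ_le /hp.
Qed.

Lemma cone_gen_over W P :
  (forall p, p \in P -> poly_over W p) ->
  forall p, cone_gen P p -> poly_over W p.
Proof. exact: cone_gen_supp. Qed.

Lemma alg_cone_ideal W ZP p : ideal_gen W ZP.1 p -> alg_cone W ZP p.
Proof. by move=> h; exists p, 0; rewrite addr0; split=> //; apply: cone_gen0. Qed.

Lemma alg_cone_cone W ZP p : cone_gen ZP.2 p -> alg_cone W ZP p.
Proof. by move=> h; exists 0, p; rewrite add0r; split=> //; apply: ideal_gen0. Qed.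

Lemma alg_coneD W ZP p q :
  alg_cone W ZP p -> alg_cone W ZP q -> alg_cone W ZP (p + q).
Proof.
move=> [a [b [ha hb ->]]] [a' [b' [ha' hb' ->]]]; exists (a + a'), (b + b').
split; [exact: ideal_genD|exact: cone_genD|by rewrite addrACA].
Qed.

Lemma alg_coneZ W ZP c p : 0 <= c -> alg_cone W ZP p -> alg_cone W ZP (c *: p).
Proof.
move=> hc [a [b [ha hb ->]]]; exists (c *: a), (c *: b).
split; [exact: ideal_genZ|exact: cone_genZ|by rewrite scalerDr].
Qed.

Lemma alg_cone_ind W ZP (C : {mpoly rat[n]} -> Prop) :
  (forall p q, C p -> C q -> C (p + q)) ->
  (forall p, ideal_gen W ZP.1 p -> C p) ->
  (forall p, cone_gen ZP.2 p -> C p) ->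
  forall p, alg_cone W ZP p -> C p.
Proof. by move=> CD C1 C2 p [a [b [/C1 ha /C2 hb ->]]]; apply: CD. Qed.

Lemma alg_cone_over W ZP :
  (forall p, p \in ZP.1 -> poly_over W p) ->
  (forall p, p \in ZP.2 -> poly_over W p) ->
  forall p, alg_cone W ZP p -> poly_over W p.
Proof.
move=> h1 h2; apply: alg_cone_ind; first exact: poly_overD.
  exact: ideal_gen_over.
exact: cone_gen_over.
Qed.

Definition fourier_motzkin_step (m : 'X_{1..n}) S : seq {mpoly rat[n]} :=
  [seq p <- S | p@_m == 0] ++
  [seq (- q@_m) *: p + p@_m *: q | p <- [seq p <- S | 0 < p@_m],
                                   q <- [seq q <- S | q@_m < 0]].

Lemma fourier_motzkin_step_supp m S (N : pred 'X_{1..n}) :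
  (forall p, p \in S -> in_span N p) ->
  forall p, p \in fourier_motzkin_step m S -> in_span (predI N (predC1 m)) p.
Proof.
move=> hS p; rewrite mem_cat mem_filter => /orP[/andP[/eqP pm /hS /allP pS]|].
  apply/allP => m' /= hm'; rewrite pS //=.
  by apply: contraTneq hm' => ->; rewrite mcoeff_msupp pm eqxx.
case/allpairsP => -[u v] /=; rewrite !mem_filter => -[/andP[_ /hS /allP hu]].
move=> /andP[_ /hS /allP hv] ->; apply/allP => m' hm' /=; apply/andP; split.
  have := msuppD_le hm'; rewrite mem_cat.
  by case/orP => /msuppZ_le; [apply: hu|apply: hv].
apply: contraTneq hm' => ->; rewrite mcoeff_msupp mcoeffD !mcoeffZ.
by rewrite mulrC mulrN addNr eqxx.
Qed.

(** In a combination whose coefficient at [m] vanishes, the positive and negative contributions to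
    that coefficient have the same total weight, so the generators of opposite signs can be
    regrouped into cancelling pairs. *)
Lemma fourier_motzkin_step_cone m S p :
  cone_gen (fourier_motzkin_step m S) p <-> cone_gen S p /\ p@_m = 0.
Proof.
split=> [|[]].
  move: p; apply: cone_gen_ind.
  - by split; [exact: cone_gen0|rewrite mcoeff0].
  - by move=> p q [hp pm] [hq qm]; split; [exact: cone_genD|rewrite mcoeffD pm qm addr0].
  move=> c p hc; rewrite mem_cat mem_filter mcoeffZ.
  case/orP => [/andP[/eqP pm pS]|].
    by rewrite pm mulr0; split => //; apply/cone_genZ/cone_gen_mem.
  case/allpairsP => -[u v] /=; rewrite !mem_filter => -[/andP[hu uS] /andP[hv vS] ->].
  split; last by rewrite mcoeffD !mcoeffZ; ring.
  apply: cone_genZ => //; apply: cone_genD; apply: cone_genZ.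
  - by rewrite oppr_ge0 ltW.
  - exact: cone_gen_mem.
  - exact: ltW.
  - exact: cone_gen_mem.
case=> c [hc ->]; set I := 'I_(size S).
pose zer (i : I) := S`_i@_m == 0; pose pos (i : I) := 0 < S`_i@_m.
pose neg (i : I) := S`_i@_m < 0.
have split3 (V : zmodType) (F : I -> V) : \sum_i F i =
    \sum_(i | zer i) F i + \sum_(i | pos i) F i + \sum_(i | neg i) F i.
  rewrite (bigID zer) /= -addrA; congr (_ + _); rewrite (bigID pos) /=.
  by congr (_ + _); apply: eq_bigl => i; rewrite /zer /pos /neg; case: ltgtP.
rewrite raddf_sum /= !split3.
have -> : \sum_(i | zer i) (c i *: S`_i)@_m = 0.
  by apply: big1 => i /eqP zi; rewrite mcoeffZ zi mulr0.
rewrite add0r; set T := \sum_(i | pos i) _ => /eqP.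
rewrite addr_eq0 -sumrN => /eqP TE.
have hzer : cone_gen (fourier_motzkin_step m S) (\sum_(i | zer i) c i *: S`_i).
  apply: big_ind; [exact: cone_gen0|exact: cone_genD|move=> i zi].
  apply/cone_genZ/cone_gen_mem => //.
  by rewrite mem_cat mem_filter /= [_ == _]zi mem_nth.
have posT (i : I) : pos i -> 0 <= (c i *: S`_i)@_m.
  by move=> pi; rewrite mcoeffZ mulr_ge0 // ltW.
have negT (i : I) : neg i -> 0 <= - (c i *: S`_i)@_m.
  by move=> ni; rewrite mcoeffZ -mulrN mulr_ge0 // oppr_ge0 ltW.
(* The pairing below divides by [T]. If [T] is zero, all summands of both one-signed sums vanish and
   only the generators with zero coefficient remain. *)
have [T0|T0] := eqVneq T 0.
  rewrite [X in _ + X + _]big1 ?addr0 => [|i pi].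
    rewrite [X in _ + X]big1 ?addr0 // => i ni.
    have /eqP := T0; rewrite TE psumr_eq0 // => /allP/(_ i (mem_index_enum _)).
    rewrite ni mcoeffZ oppr_eq0 mulf_eq0 (lt_eqF ni) orbF => /eqP ->.
    by rewrite scale0r.
  have /eqP := T0; rewrite psumr_eq0 // => /allP/(_ i (mem_index_enum _)).
  rewrite pi mcoeffZ mulf_eq0 (gt_eqF pi) orbF => /eqP ->.
  by rewrite scale0r.
have T_ge0 : 0 <= T by apply: sumr_ge0.
rewrite -addrA; apply: cone_genD => //.
(* With T the common total weight of both signs, sum a_i p_i + sum b_j q_j is
   the combination of the pairs (p_i, q_j) with weights a_i b_j / T. *)
have -> : \sum_(i | pos i) c i *: S`_i + \sum_(j | neg j) c j *: S`_j =
    \sum_(i | pos i) \sum_(j | neg j)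
      (c i * c j / T) *: ((- S`_j@_m) *: S`_i + S`_i@_m *: S`_j).
  under [RHS]eq_bigr => i _ do
    (under eq_bigr => j _ do rewrite scalerDr; rewrite big_split /=).
  rewrite big_split /=; congr (_ + _).
    apply: eq_bigr => i _; rewrite -[LHS]scale1r -[1](divff T0) {1}TE mulr_suml scaler_suml.
    apply: eq_bigr => j _; rewrite !scalerA mcoeffZ; congr (_ *: _).
    by ring.
  rewrite exchange_big /=.
  apply: eq_bigr => j _; rewrite -[LHS]scale1r -[1](divff T0) {1}/T mulr_suml scaler_suml.
  apply: eq_bigr => i _; rewrite !scalerA mcoeffZ; congr (_ *: _).
  by ring.
apply: big_ind => [||i pi]; [exact: cone_gen0|exact: cone_genD|].
apply: big_ind => [||j nj]; [exact: cone_gen0|exact: cone_genD|].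
apply: cone_genZ; first by rewrite divr_ge0 // mulr_ge0.
apply: cone_gen_mem; rewrite mem_cat; apply/orP; right.
by apply/allpairsP; exists (S`_i, S`_j); rewrite !mem_filter /= [_ < _]pi [_ < _]nj !mem_nth.
Qed.

(** Finitely many monomials occur in [S], and they are eliminated one at a time; the list [r]
    contains those that may still occur outside [N]. *)
Lemma proj_exists S (N : pred 'X_{1..n}) : exists P, is_proj S N P.
Proof.
suff main (r : seq 'X_{1..n}) S0 :
    (forall p, p \in S0 -> in_span (fun m => N m || (m \in r)) p) ->
    exists P, is_proj S0 N P.
  apply: (main (flatten [seq msupp p | p <- S])) => p pS.
  apply/allP => m mp; apply/orP; right; apply/flattenP.
  by exists (msupp p) => //; apply: map_f.
elim: r S0 => [|m r IH] S0 hS.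
  exists S0 => p; split=> [hp|[]//]; split=> //; apply: cone_gen_supp hp => q /hS.
  by apply: sub_all => m; rewrite orbF.
have [Nm|Nm] := boolP (N m).
  apply: IH => p /hS; apply: sub_all => m'; rewrite inE.
  by case: eqVneq => [->|//]; rewrite Nm.
have [|P hP] := IH (fourier_motzkin_step m S0).
  move=> p /(fourier_motzkin_step_supp (m := m) hS); apply: sub_all => m' /=; rewrite inE.
  by case: eqVneq => //=; rewrite ?andbF ?andbT.
exists P => p; rewrite hP fourier_motzkin_step_cone; split=> [[[]]//|[h1 h2]]; do !split=> //.
apply: memN_msupp_eq0; apply: contra Nm; exact: (allP h2).
Qed.

End IdealsCones.

(** * Groebner bases, projection and intersection *)

(** Finite choice, used to pick polynomials with prescribed leading monomials and to list normal
    forms. *)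
Lemma seq_choice (T U : eqType) (R : T -> U -> Prop) (s : seq T) :
  (forall x, x \in s -> exists y, R x y) ->
  exists s' : seq U, (forall y, y \in s' -> exists2 x, x \in s & R x y) /\
                     (forall x, x \in s -> exists2 y, y \in s' & R x y).
Proof.
elim: s => [|x s IH] h; first by exists [::].
have [y Rxy] := h x (mem_head _ _).
have [|s' [h1 h2]] := IH; first by move=> z zs; apply: h; rewrite inE zs orbT.
exists (y :: s'); split=> z; rewrite inE => /orP[/eqP ->|].
- by exists x; rewrite ?mem_head.
- by move=> /h1 [u us Ru]; exists u; rewrite // inE us orbT.
- by exists y; rewrite ?mem_head.
- by move=> /h2 [u us Ru]; exists u; rewrite // inE us orbT.
Qed.

(** Dickson's lemma, by induction on the number [k] of exponents taken into account in the
    divisibility test. *)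
Lemma dickson (n : nat) (Q : 'X_{1..n} -> Prop) :
  exists L : seq 'X_{1..n}, (forall m, m \in L -> Q m) /\
    (forall m, Q m -> exists2 l, l \in L & (l <= m)%MM).
Proof.
suff main k : forall Q : 'X_{1..n} -> Prop,
    exists L : seq 'X_{1..n}, (forall m, m \in L -> Q m) /\
      (forall m, Q m -> exists2 l, l \in L &
         forall i : 'I_n, (i < k)%N -> (l i <= m i)%N).
  have [L [h1 h2]] := main n Q; exists L; split=> // m /h2 [l lL hl].
  by exists l => //; apply/mnm_lepP => i; apply: hl.
elim: k => [|k IH] {}Q.
  case: (classic (exists m, Q m)) => [[m Qm]|nQ].
    by exists [:: m]; split=> [m'|m' _]; [rewrite inE => /eqP ->|exists m; rewrite ?mem_head].
  by exists [::]; split=> // m Qm; case: nQ; exists m.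
have [lt_kn|le_nk] := ltnP k n; last first.
  have [L [h1 h2]] := IH Q; exists L; split=> // m /h2 [l lL hl]; exists l => // i _.
  by apply: hl; apply: leq_trans (ltn_ord i) le_nk.
pose o := Ordinal lt_kn; have [L0 [h1 h2]] := IH Q.
pose B := \max_(l <- L0) l o.
(* Above the bound B the basis L0 for the first k exponents suffices; below B,
   the exponent of o takes finitely many values. *)
suff [L [hL1 hL2]] : exists L : seq 'X_{1..n}, (forall m, m \in L -> Q m) /\
    (forall m, Q m -> (m o < B)%N -> exists2 l, l \in L &
         forall i : 'I_n, (i < k.+1)%N -> (l i <= m i)%N).
  exists (L0 ++ L); split=> [m|m Qm]; first by rewrite mem_cat => /orP[/h1|/hL1].
  have [lt_mB|le_Bm] := ltnP (m o) B.
    by have [l lL hl] := hL2 m Qm lt_mB; exists l; rewrite // mem_cat lL orbT.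
  have [l lL hl] := h2 m Qm; exists l; first by rewrite mem_cat lL.
  move=> i; rewrite ltnS leq_eqVlt => /orP[/eqP ik|]; last exact: hl.
  have -> : i = o by apply: val_inj.
  by apply: leq_trans le_Bm; rewrite /B (big_rem l) //= leq_maxl.
elim: B => [|B [L [hL1 hL2]]]; first by exists [::].
have [L' [hL'1 hL'2]] := IH (fun m => Q m /\ m o = B).
exists (L ++ L'); split=> [m|m Qm].
  by rewrite mem_cat => /orP[/hL1|/hL'1 []].
rewrite ltnS leq_eqVlt => /orP[/eqP mB|/(hL2 m Qm) [l lL hl]]; last first.
  by exists l; rewrite // mem_cat lL.
have [l lL' hl] := hL'2 m (conj Qm mB); exists l.
  by rewrite mem_cat lL' orbT.
move=> i; rewrite ltnS leq_eqVlt => /orP[/eqP ik|]; last exact: hl.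
have -> : i = o by apply: val_inj.
by have [_ ->] := hL'1 l lL'; rewrite mB.
Qed.

Lemma total_seq_min (T : eqType) (r : rel T) (s : seq T) :
  reflexive r -> transitive r -> total r -> s != [::] ->
  exists2 x, x \in s & forall y, y \in s -> r x y.
Proof.
move=> r_refl r_tr r_tot; elim: s => // x s IH _.
have [->|/IH [y ys hy]] := eqVneq s [::].
  by exists x; rewrite ?mem_head // => y; rewrite inE => /eqP ->.
case/orP: (r_tot x y) => hxy.
  exists x; rewrite ?mem_head // => z; rewrite inE => /orP[/eqP ->//|/hy].
  exact: r_tr hxy.
exists y; first by rewrite inE ys orbT.
by move=> z; rewrite inE => /orP[/eqP ->//|/hy].
Qed.

Section Groebner.
Variables (n : nat) (le : rel 'X_{1..n}) (le_mo : monomial_order le).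
Implicit Types (W : {set 'I_n}) (p q r g : {mpoly rat[n]}) (m : 'X_{1..n}).
Implicit Types (Z P G S : seq {mpoly rat[n]}).

Lemma mo_dvd m m' : (m' <= m)%MM -> le m' m.
Proof.
move=> /submK <-; rewrite -{1}[m'](add0m m').
exact/(mo_mul le_mo)/(mo_one le_mo).
Qed.

Lemma mo_eq m m' : le m m' -> le m' m -> m = m'.
Proof. by move=> h1 h2; apply: (mo_antisym le_mo); rewrite h1 h2. Qed.

(** Well-foundedness of a monomial order: a finite Dickson basis of [Q] has a least element, and a
    divisor is always below its multiples. *)
Lemma mo_min (Q : 'X_{1..n} -> Prop) :
  (exists m, Q m) -> exists2 m, Q m & forall m', Q m' -> le m m'.
Proof.
move=> [m0 Qm0]; have [L [h1 h2]] := dickson Q.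
have L0 : L != [::] by have [l] := h2 _ Qm0; case: (L).
have [m mL hm] := total_seq_min (mo_refl le_mo) (mo_trans le_mo) (mo_total le_mo) L0.
exists m; first exact: h1.
move=> m' /h2 [l lL /mo_dvd]; apply: (mo_trans le_mo); exact: hm.
Qed.

Lemma lead_mon_exists p : p != 0 -> exists m, lead_mon le p m.
Proof.
move=> p0; have [||||m mp hm] := @total_seq_min _ (fun x y => le y x) (msupp p).
- exact: mo_refl le_mo.
- by move=> x y z h1 h2; apply: (mo_trans le_mo) h2 h1.
- by move=> x y; apply: (mo_total le_mo y x).
- by rewrite msupp_eq0.
by exists m.
Qed.

(** Polynomial division, run on a counterexample with minimal leading monomial. A reducible leading
    term is cancelled by a multiple of an element of [G]; an irreducible one is set aside and added
    back to the normal form of the rest. *)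
Lemma nf_exists W G p :
  (forall g, g \in G -> poly_over W g) -> poly_over W p ->
  exists r, normal_form le W G p r.
Proof.
move=> GW pW; apply: NNPP => no_nf.
have nf0 : exists r, normal_form le W G 0 r.
  exists 0; split; first by rewrite subrr; apply: ideal_gen0.
  by move=> m g m'; rewrite -mpolyC0 msupp0.
pose Q m := exists p, [/\ poly_over W p, lead_mon le p m
                        & ~ exists r, normal_form le W G p r].
have [|m {}[{}p [{}pW [mp lead_m] {}no_nf]] min_m] := mo_min (Q := Q).
  have [p0|/lead_mon_exists [m hm]] := eqVneq p 0; first by rewrite p0 in no_nf.
  by exists m, p.
have smaller q : poly_over W q ->
    (forall m', m' \in msupp q -> le m' m /\ m' != m) ->
    exists r, normal_form le W G q r.
  move=> qW hq; apply: NNPP => no_nfq.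
  have [q0|/lead_mon_exists [m' hm']] := eqVneq q 0; first by rewrite q0 in no_nfq.
  have [m'q _] := hm'; have [le_m' /eqP ne_m'] := hq m' m'q.
  by apply: ne_m'; apply: mo_eq => //; apply: min_m; exists q.
apply: no_nf.
case: (classic (exists g m', [/\ g \in G, lead_mon le g m' & (m' <= m)%MM])).
  case=> g [m' [gG [m'g lead_g] dvd_m]].
  pose c := p@_m / g@_m'; pose u := c *: (g * 'X_[m - m']).
  have mW : mon_over W m by apply: (poly_overP _ _ pW).
  have XW : poly_over W 'X_[m - m'].
    by apply/poly_overX/(mon_over_le _ mW)/lem_subr.
  have gm'0 : g@_m' != 0 by rewrite -mcoeff_msupp.
  have um : u@_m = p@_m.
    by rewrite mcoeffZ -{1}(submK dvd_m) mcoeffMX divfK.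
  have [||r [hr1 hr2]] := smaller (p - u).
  - by apply: poly_overB => //; apply/poly_overZ/poly_overM => //; apply: GW.
  - move=> k hk; split.
      have := msuppB_le hk; rewrite mem_cat => /orP[/lead_m //|/msuppZ_le].
      rewrite (perm_mem (msuppMX _ _)) => /mapP [k' /lead_g k'g ->].
      rewrite -[X in le _ X](submK dvd_m) !(addmC (m - m')%MM).
      exact: (mo_mul le_mo).
    by apply: contraTneq hk => ->; rewrite mcoeff_msupp mcoeffB um subrr eqxx.
  exists r; split=> //; have -> : p - r = (p - u - r) + u.
    by rewrite [RHS]addrAC subrK.
  apply: ideal_genD => //; apply: ideal_genZ; rewrite mulrC.
  by apply: ideal_genM => //; apply: ideal_gen_mem.
move=> irr; pose u := p@_m *: 'X_[rat, m].
have [||r [hr1 hr2]] := smaller (p - u).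
- apply: poly_overB => //; apply/poly_overZ/poly_overX.
  exact: (poly_overP _ _ pW).
- move=> k; rewrite (perm_mem (msupp_rem _ _)) mem_rem_uniq ?msupp_uniq //.
  by rewrite inE => /andP[/= ne_k /lead_m].
exists (r + u); split; first by rewrite [r + u]addrC opprD addrA.
move=> k g m' hk gG hm'; have := msuppD_le hk.
rewrite mem_cat => /orP[kr|/msuppZ_le]; first exact: hr2 hm'.
rewrite msuppX inE => /eqP ->; apply/negP => dvd_m.
by apply: irr; exists g, m'.
Qed.

(** The difference lies in the ideal. If it were nonzero, its leading monomial would be reducible by
    [G], yet it occurs in [r1] or in [r2]. *)
Lemma nf_unique W G Z p r1 r2 : groebner le W G Z ->
  normal_form le W G p r1 -> normal_form le W G p r2 -> r1 = r2.
Proof.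
move=> [GZ hG] [h1 irr1] [h2 irr2]; apply/eqP; rewrite -subr_eq0; apply/eqP.
apply: NNPP => /eqP /lead_mon_exists [m hm]; have [mr _] := hm.
have [||g [m' [gG hm' dvd_m]]] := hG (r1 - r2) m => //.
  apply/GZ; have -> : r1 - r2 = (p - r2) - (p - r1).
    by rewrite opprB [RHS]addrC addrA subrK.
  exact: ideal_genB.
have := msuppB_le mr; rewrite mem_cat => /orP[] mr'.
  by have /negP := irr1 m g m' mr' gG hm'.
by have /negP := irr2 m g m' mr' gG hm'.
Qed.

Lemma groebner_over W G Z : (forall z, z \in Z -> poly_over W z) ->
  groebner le W G Z -> forall g, g \in G -> poly_over W g.
Proof.
by move=> ZW [GZ _] g gG; apply: (ideal_gen_over ZW); apply/GZ/ideal_gen_mem.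
Qed.

(** Dickson's lemma is applied to the leading monomials of the ideal. The chosen polynomials
    generate the ideal, because the normal form of an element of it is again in the ideal and
    irreducible, hence zero. *)
Lemma groebner_exists W Z :
  (forall z, z \in Z -> poly_over W z) -> exists G, groebner le W G Z.
Proof.
move=> ZW; pose Q m := exists p, ideal_gen W Z p /\ lead_mon le p m.
have [L [/seq_choice [G [h1 h2]] h3]] := dickson Q.
have GZ g : g \in G -> ideal_gen W Z g by move=> /h1 [m _ []].
have lead p m : ideal_gen W Z p -> lead_mon le p m ->
    exists g m', [/\ g \in G, lead_mon le g m' & (m' <= m)%MM].
  move=> hp hm; have [|l lL dvd_m] := h3 m; first by exists p.
  by have [g gG [_ hg]] := h2 l lL; exists g, l.
exists G; split=> // p; split; first exact: ideal_gen_sub.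
move=> hp.
have [||r [h irr]] := @nf_exists W G p.
- by move=> g /GZ; apply: ideal_gen_over.
- exact: ideal_gen_over hp.
suff r0 : r = 0 by rewrite r0 subr0 in h.
apply: NNPP => /eqP /lead_mon_exists [m hm].
have [|g [m' [gG hm' dvd_m]]] := lead r m _ hm.
  rewrite -[r](subKr p); apply: ideal_genB => //.
  by apply: ideal_gen_sub h.
by have /negP := irr m g m' (proj1 hm) gG hm'.
Qed.

Lemma nf_seq_exists W G Z P :
  (forall z, z \in Z -> poly_over W z) -> (forall p, p \in P -> poly_over W p) ->
  groebner le W G Z ->
  exists S, forall s, s \in S <-> exists2 p, p \in P & normal_form le W G p s.
Proof.
move=> ZW PW hG.
have [|S [h1 h2]] := @seq_choice _ _ (normal_form le W G) P.
  move=> p /PW; apply: nf_exists; exact: groebner_over hG.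
exists S => s; split=> [/h1 //|[p pP hp]].
by have [s' s'S hs'] := h2 p pP; rewrite (nf_unique hG hp hs').
Qed.

(** A generator of the cone and its normal form differ by an element of the ideal. *)
Lemma alg_cone_nf W G Z P S :
  groebner le W G Z ->
  (forall s, s \in S <-> exists2 p, p \in P & normal_form le W G p s) ->
  (forall z, z \in Z -> poly_over W z) -> (forall p, p \in P -> poly_over W p) ->
  forall p, alg_cone W (G, S) p <-> alg_cone W (Z, P) p.
Proof.
move=> hG hS ZW PW p; have [GZ _] := hG; split; move: p; apply: alg_cone_ind => /=.
- exact: alg_coneD.
- by move=> p /GZ hp; apply: alg_cone_ideal.
- apply: cone_gen_ind; [exact/alg_cone_ideal/ideal_gen0|exact: alg_coneD|].
  move=> c s hc /hS [p pP [hps _]]; apply: alg_coneZ => //.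
  rewrite -[s](subKr p); apply: alg_coneD; first exact/alg_cone_cone/cone_gen_mem.
  by apply/alg_cone_ideal/ideal_genN/GZ.
- exact: alg_coneD.
- by move=> p /GZ hp; apply: alg_cone_ideal.
- apply: cone_gen_ind; [exact/alg_cone_ideal/ideal_gen0|exact: alg_coneD|].
  move=> c p hc pP; apply: alg_coneZ => //.
  have [s hs] := nf_exists (groebner_over ZW hG) (PW p pP); have [hps _] := hs.
  rewrite -[p](subrK s); apply: alg_coneD; first exact: alg_cone_ideal.
  by apply/alg_cone_cone/cone_gen_mem/hS; exists p.
Qed.

Lemma reduce_exists W Z P :
  (forall z, z \in Z -> poly_over W z) -> (forall p, p \in P -> poly_over W p) ->
  exists2 ZP, reduced le W ZP &
              forall p, alg_cone W ZP p <-> alg_cone W (Z, P) p.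
Proof.
move=> ZW PW; have [G hG] := groebner_exists ZW.
have [S hS] := nf_seq_exists ZW PW hG; have [GZ lead] := hG.
exists (G, S); last exact: alg_cone_nf hG hS ZW PW.
split=> [|s /hS [p _ [_ irr]]]; last first.
  by split=> //; rewrite subrr; apply: ideal_gen0.
by split=> // p m /GZ; apply: lead.
Qed.

End Groebner.

(** * Elimination orderings and projection to Q[X] *)

Section Elimination.
Variables (n : nat) (le : rel 'X_{1..n}) (le_mo : monomial_order le).
Variable X : {set 'I_n}.
Implicit Types (W : {set 'I_n}) (m : 'X_{1..n}).
Implicit Types (p q r g : {mpoly rat[n]}) (ZP : zp_pair n).

Lemma mon_partD W m m' :
  mon_part W (m + m')%MM = (mon_part W m + mon_part W m')%MM.
Proof. by apply/mnmP => i; rewrite mnmDE !mnmE; case: ifP. Qed.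

Lemma mon_part_inj m m' : mon_part X m = mon_part X m' ->
  mon_part (~: X) m = mon_part (~: X) m' -> m = m'.
Proof.
move=> /mnmP h1 /mnmP h2; apply/mnmP => i.
by have := h1 i; have := h2 i; rewrite !mnmE inE; case: (i \in X).
Qed.

Lemma mon_part0 W : mon_part W 0%MM = 0%MM :> 'X_{1..n}.
Proof. by apply/mnmP => i; rewrite mnmE !mnm0E if_same. Qed.

Lemma mon_part_over m : mon_over X m -> mon_part X m = m.
Proof.
move=> /mon_overP h; apply/mnmP => i; rewrite mnmE.
by case: ifPn => // /h.
Qed.

Lemma mon_partC_over m : (mon_part (~: X) m == 0%MM) = mon_over X m.
Proof.
apply/eqP/mon_overP => [/mnmP h i iX|h].
  by have := h i; rewrite mnmE mnm0E inE iX.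
by apply/mnmP => i; rewrite mnmE mnm0E inE; case: ifP => // /h.
Qed.

Lemma elim_order_monomial : monomial_order (elim_order le X).
Proof.
have le_refl := mo_refl le_mo; have le_eq := @mo_eq _ _ le_mo.
rewrite /elim_order; split.
- by move=> m; rewrite eqxx.
- move=> m m' /andP[]; rewrite [mon_part (~: X) m' == _]eq_sym; case: eqP => e h1 h2.
    by apply: mon_part_inj e; apply: le_eq.
  by case: e; apply: le_eq.
- move=> y x z; case: eqP => [->|ne1]; case: eqP => [e|ne2] h1 h2.
  + exact: (mo_trans le_mo) h1 h2.
  + exact: h2.
  + by rewrite -e; case: eqP.
  case: eqP => [e|_]; last exact: (mo_trans le_mo) h1 h2.
  by case: ne1; apply: le_eq => //; rewrite e.
- move=> x y; rewrite [mon_part (~: X) y == _]eq_sym; case: eqP => _; exact: mo_total.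
- by move=> m; rewrite !mon_part0; case: eqP => _; apply: mo_one.
- move=> m1 m2 m; rewrite !mon_partD eqm_add2r.
  by case: eqP => _; apply: mo_mul.
Qed.

Lemma elim_orderE m m' : mon_over X m -> mon_over X m' ->
  elim_order le X m m' = le m m'.
Proof.
move=> hm hm'; rewrite /elim_order !mon_part_over //.
by have := hm; have := hm'; rewrite -!mon_partC_over => /eqP -> /eqP ->; rewrite eqxx.
Qed.

(** The part of [m] outside [X] is the monomial 1, which is least, so the same holds for every
    smaller monomial. This is what makes the ordering eliminate variables. *)
Lemma elim_order_over m m' :
  elim_order le X m' m -> mon_over X m -> mon_over X m'.
Proof.
rewrite /elim_order -!mon_partC_over => h /eqP e; move: h; rewrite e.
by case: eqP => // ne h; case: ne; apply: (mo_eq le_mo h); apply: (mo_one le_mo).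
Qed.

Lemma lead_elim g m : lead_mon (elim_order le X) g m -> mon_over X m ->
  poly_over X g.
Proof.
by move=> [_ h] hm; apply/poly_overP => m' /h /elim_order_over; apply.
Qed.

Lemma lead_elimE g m : poly_over X g ->
  lead_mon (elim_order le X) g m <-> lead_mon le g m.
Proof.
move=> /poly_overP gX; split=> -[mg h]; split=> // m' m'g.
  by rewrite -elim_orderE ?gX // h.
by rewrite elim_orderE ?gX // h.
Qed.

Variables (V : {set 'I_n}) (X_sub_V : X \subset V).

Definition zp_over W ZP := (forall z, z \in ZP.1 -> poly_over W z) /\
                           (forall p, p \in ZP.2 -> poly_over W p).

Lemma project_over ZP ZP' : project le V X ZP ZP' -> zp_over X ZP'.
Proof.
move=> [G [S [_ _ EG hP]]]; split=> p; first by rewrite EG mem_filter => /andP[].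
by move=> /cone_gen_mem /hP [].
Qed.

Lemma cone_gen_irr (G S : seq {mpoly rat[n]}) :
  (forall s, s \in S -> normal_form (elim_order le X) V G s s) ->
  forall p m g m', cone_gen S p -> m \in msupp p -> g \in G ->
    lead_mon (elim_order le X) g m' -> ~~ (m' <= m)%MM.
Proof.
move=> hS p m g m' hp mp gG hm'.
suff /allP : in_span (fun m => ~~ (m' <= m)%MM) p by apply.
apply: cone_gen_supp hp => s sS; apply/allP => k ks.
by have [_ irr] := hS s sS; apply: irr hm'.
Qed.

Lemma normal_form_id (le' : rel 'X_{1..n}) W G p r :
  normal_form le' W G p r -> normal_form le' W G r r.
Proof. by move=> [_ irr]; split=> //; rewrite subrr; apply: ideal_gen0. Qed.

(** An element of [G] whose leading monomial divides a monomial over [X] lies in Q[X], so it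
    survives the filter; on Q[X] the elimination ordering agrees with [le]. *)
Lemma project_reduced ZP ZP' : zp_over V ZP ->
  project le V X ZP ZP' -> reduced le X ZP'.
Proof.
move=> ZPV [G [S [hG hS EG hP]]]; have [GZ lead] := hG.
split; last first.
  move=> p pP; split; first by rewrite subrr; apply: ideal_gen0.
  move=> m g m' mp; rewrite EG mem_filter => /andP[gX gG] /(lead_elimE _ gX) hm'.
  have /hP [pS _] := cone_gen_mem pP.
  apply: (cone_gen_irr _ pS mp gG hm') => s /hS [q _]; exact: normal_form_id.
split=> // p m; rewrite EG => hp hm.
have pX : poly_over X p.
  by apply: ideal_gen_over hp => z; rewrite mem_filter => /andP[].
have [|g [m' [gG hm' dvd_m]]] := lead p m _ (proj2 (lead_elimE _ pX) hm).
  apply/GZ; apply: ideal_gen_sub hp => // z; rewrite mem_filter => /andP[_].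
  exact: ideal_gen_mem.
have gX : poly_over X g.
  apply: lead_elim hm' _; apply: mon_over_le dvd_m _.
  by apply: (poly_overP _ _ pX); case: hm.
by exists g, m'; rewrite mem_filter gX gG; split=> //; apply/lead_elimE.
Qed.

(** If [p] in Q[X] is [a + b] with [b] in the cone of the normal forms, then [b] is the normal form
    of [p] modulo [G]. The normal form [r] of [p] modulo the elements of [G] in Q[X] is also
    irreducible modulo all of [G]. By uniqueness [b = r], so both summands lie in Q[X]. *)
Lemma project_cone ZP ZP' : zp_over V ZP -> project le V X ZP ZP' ->
  forall p, alg_cone X ZP' p <-> alg_cone V ZP p /\ poly_over X p.
Proof.
case: ZP ZP' => [Z P] [Z' P'] ZPV /[dup] prj [G [S [/= hG hS EG hP]]] p.
have [/= ZV PV] := ZPV; have [GZ lead] := hG.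
have elim_mo := elim_order_monomial.
have hcone := alg_cone_nf elim_mo hG hS ZV PV.
split.
  have [h1 h2] := project_over prj.
  move=> hp; split; last exact: alg_cone_over hp.
  move: hp => [a [b [/= ha hb ->]]]; apply/hcone; exists a, b; split=> //=.
    apply: ideal_gen_sub ha => // z; rewrite EG mem_filter => /andP[_].
    exact: ideal_gen_mem.
  by have /hP [] := hb.
move=> [/hcone [a [b [/= ha hb pE]]] pX].
have [g0|r [hr irr]] := @nf_exists _ _ elim_mo X Z' p _ pX.
  by rewrite EG mem_filter => /andP[].
have rX : poly_over X r.
  rewrite -[r](subKr p); apply: poly_overB => //; apply: ideal_gen_over hr.
  by rewrite EG => g; rewrite mem_filter => /andP[].
suff br : b = r.
  exists (p - b), b; split=> //=; last by rewrite subrK.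
    by rewrite br.
  by apply/hP; rewrite br; split=> //; rewrite -br.
apply: (nf_unique (p := p) elim_mo hG); split.
- by rewrite pE addrK.
- move=> m g m' mb gG hm'.
  apply: (cone_gen_irr _ hb mb gG hm') => s /hS [q _]; exact: normal_form_id.
- apply: ideal_gen_sub hr => // g; rewrite EG mem_filter => /andP[_].
  exact: ideal_gen_mem.
(* An element of [G] able to reduce [r] has its leading monomial over [X], so it belongs to [Z'],
   modulo which [r] is irreducible. *)
move=> m g m' mr gG hm'; apply/negP => dvd_m.
have gX : poly_over X g.
  apply: lead_elim hm' _; apply: mon_over_le dvd_m _.
  exact: (poly_overP _ _ rX).
have gZ' : g \in Z' by rewrite EG mem_filter gX.
by have /negP := irr m g m' mr gZ' hm'.
Qed.

Lemma project_exists ZP : zp_over V ZP -> exists ZP', project le V X ZP ZP'.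
Proof.
move=> [ZV PV]; have elim_mo := elim_order_monomial.
have [G hG] := groebner_exists elim_mo ZV.
have [S hS] := nf_seq_exists elim_mo ZV PV hG.
have [P hP] := proj_exists S (mon_over X).
by exists ([seq g <- G | poly_over X g], P), G, S.
Qed.

End Elimination.

(** * Intersection of algebraic cones by a fresh variable *)

Section Intersection.
Variables (n : nat) (le : rel 'X_{1..n}) (le_mo : monomial_order le).
Variables (X : {set 'I_n}) (t : 'I_n) (t_fresh : t \notin X).
Implicit Types (p q : {mpoly rat[n]}) (ZP : zp_pair n).

Let V := t |: X.
Let X_sub_V : X \subset V. Proof. exact: subsetUr. Qed.
Let XtV : poly_over V 'X_t. Proof. by apply: poly_overXU; rewrite setU11. Qed.
Let XtCV : poly_over V (1 - 'X_t).
Proof. by apply: poly_overB => //; apply: poly_over1. Qed.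

Definition tmix ZP1 ZP2 : zp_pair n :=
  (scale_seq 'X_t ZP1.1 ++ scale_seq (1 - 'X_t) ZP2.1,
   scale_seq 'X_t ZP1.2 ++ scale_seq (1 - 'X_t) ZP2.2).

Lemma tmix_over ZP1 ZP2 : zp_over X ZP1 -> zp_over X ZP2 ->
  zp_over V (tmix ZP1 ZP2).
Proof.
move=> [h1 h2] [h3 h4]; split=> p; rewrite mem_cat.
  by case/orP => /mapP [z /[dup] hz]; [move/h1|move/h3] => zX ->;
    apply: poly_overM => //; apply: poly_overS zX.
by case/orP => /mapP [z /[dup] hz]; [move/h2|move/h4] => zX ->;
    apply: poly_overM => //; apply: poly_overS zX.
Qed.

Lemma alg_cone_scale (W : {set 'I_n}) (f : {mpoly rat[n]}) ZP ZP' :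
  X \subset W -> poly_over W f ->
  (forall z, z \in ZP.1 -> f * z \in ZP'.1) ->
  (forall z, z \in ZP.2 -> f * z \in ZP'.2) ->
  forall p, alg_cone X ZP p -> alg_cone W ZP' (f * p).
Proof.
move=> sW fW h1 h2; apply: alg_cone_ind.
- by move=> p q hp hq; rewrite mulrDr; apply: alg_coneD.
- apply: ideal_gen_ind.
  + by rewrite mulr0; apply/alg_cone_ideal/ideal_gen0.
  + by move=> p q hp hq; rewrite mulrDr; apply: alg_coneD.
  move=> p z hp hz; rewrite mulrCA; apply/alg_cone_ideal/ideal_genM.
    exact: poly_overS hp.
  exact/ideal_gen_mem/h1.
apply: cone_gen_ind.
+ by rewrite mulr0; apply/alg_cone_ideal/ideal_gen0.
+ by move=> p q hp hq; rewrite mulrDr; apply: alg_coneD.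
move=> c z hc hz; rewrite -scalerAr; apply/alg_cone_cone/cone_genZ => //.
exact/cone_gen_mem/h2.
Qed.

Definition tset (c : rat) (i : 'I_n) : {mpoly rat[n]} :=
  if i == t then c%:MP else 'X_i.

Lemma psubst_tset c p : poly_over X p -> psubst (tset c) p = p.
Proof.
apply: psubst_id => i iX; rewrite /tset; case: eqP => // it.
by have := t_fresh; rewrite -it iX.
Qed.

Lemma tset_over c p : poly_over V p -> poly_over X (psubst (tset c) p).
Proof.
apply: psubst_over => i; rewrite /tset in_setU1; case: eqP => [_ _|_ /= iX].
  by rewrite -alg_mpolyC; apply/poly_overZ/poly_over1.
exact: poly_overXU.
Qed.

Lemma psubst_tmix c ZP ZP' :
  (forall z, z \in ZP'.1 -> ideal_gen X ZP.1 (psubst (tset c) z)) ->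
  (forall z, z \in ZP'.2 -> cone_gen ZP.2 (psubst (tset c) z)) ->
  forall p, alg_cone V ZP' p -> alg_cone X ZP (psubst (tset c) p).
Proof.
move=> h1 h2; apply: alg_cone_ind.
- by move=> p q hp hq; rewrite /psubst rmorphD; apply: alg_coneD.
- apply: ideal_gen_ind.
  + by rewrite /psubst rmorph0; apply/alg_cone_ideal/ideal_gen0.
  + by move=> p q hp hq; rewrite /psubst rmorphD; apply: alg_coneD.
  move=> p z hp hz; rewrite /psubst rmorphM; apply/alg_cone_ideal/ideal_genM.
    exact: tset_over hp.
  exact: h1.
apply: cone_gen_ind.
+ by rewrite /psubst rmorph0; apply/alg_cone_ideal/ideal_gen0.
+ by move=> p q hp hq; rewrite /psubst rmorphD; apply: alg_coneD.
move=> c' z hc hz; rewrite psubstZ; apply/alg_cone_cone/cone_genZ => //.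
exact: h2.
Qed.

(** Setting [t] to 1 keeps the generators of [ZP1] and kills those of [ZP2], and setting it to 0
    does the reverse, while [p] does not involve [t]. Conversely [p] is the sum of its multiples by
    [t] and by [1 - t]. *)
Lemma intersect_cone ZP1 ZP2 ZP' : zp_over X ZP1 -> zp_over X ZP2 ->
  intersect le X t ZP1 ZP2 ZP' ->
  forall p, alg_cone X ZP' p <-> alg_cone X ZP1 p /\ alg_cone X ZP2 p.
Proof.
move=> o1 o2 hint p; have oV := tmix_over o1 o2.
rewrite (project_cone le_mo X_sub_V oV hint).
have [[h11 h12] [h21 h22]] := (o1, o2).
have subst_t c : psubst (tset c) 'X_t = c%:MP by rewrite psubstXU /tset eqxx.
have subst_tC c : psubst (tset c) (1 - 'X_t) = 1 - c%:MP.
  by rewrite -(subst_t c) /psubst rmorphB rmorph1.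
have substM c q z : psubst (tset c) (q * z) = psubst (tset c) q * psubst (tset c) z.
  by rewrite /psubst rmorphM.
split=> [[hp pX]|[hp1 hp2]].
  split.
    rewrite -(psubst_tset 1 pX); apply: psubst_tmix hp => z; rewrite mem_cat.
      case/orP => /mapP [y yZ ->]; rewrite substM ?subst_t ?subst_tC mpolyC1.
        by rewrite mul1r psubst_tset ?h11 //; apply: ideal_gen_mem.
      by rewrite subrr mul0r; apply: ideal_gen0.
    case/orP => /mapP [y yZ ->]; rewrite substM ?subst_t ?subst_tC mpolyC1.
      by rewrite mul1r psubst_tset ?h12 //; apply: cone_gen_mem.
    by rewrite subrr mul0r; apply: cone_gen0.
  rewrite -(psubst_tset 0 pX); apply: psubst_tmix hp => z; rewrite mem_cat.
    case/orP => /mapP [y yZ ->]; rewrite substM ?subst_t ?subst_tC mpolyC0.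
      by rewrite mul0r; apply: ideal_gen0.
    by rewrite subr0 mul1r psubst_tset ?h21 //; apply: ideal_gen_mem.
  case/orP => /mapP [y yZ ->]; rewrite substM ?subst_t ?subst_tC mpolyC0.
    by rewrite mul0r; apply: cone_gen0.
  by rewrite subr0 mul1r psubst_tset ?h22 //; apply: cone_gen_mem.
split; last exact: alg_cone_over hp1.
have -> : p = 'X_t * p + (1 - 'X_t) * p by rewrite -mulrDl addrC subrK mul1r.
apply: alg_coneD.
  apply: alg_cone_scale hp1 => // z hz; rewrite mem_cat; apply/orP; left;
  exact: map_f.
apply: alg_cone_scale hp2 => // z hz; rewrite mem_cat; apply/orP; right;
exact: map_f.
Qed.

Lemma intersect_exists ZP1 ZP2 : zp_over X ZP1 -> zp_over X ZP2 ->
  exists ZP', intersect le X t ZP1 ZP2 ZP'.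
Proof.
by move=> o1 o2; apply: (project_exists le_mo X (tmix_over o1 o2)).
Qed.

Lemma intersect_reduced ZP1 ZP2 ZP' : zp_over X ZP1 -> zp_over X ZP2 ->
  intersect le X t ZP1 ZP2 ZP' -> reduced le X ZP' /\ zp_over X ZP'.
Proof.
move=> o1 o2 hint; split; last exact: project_over hint.
exact: (project_reduced le_mo X_sub_V (tmix_over o1 o2) hint).
Qed.

End Intersection.

(** * Models of LRR and regular cones *)

Section RationalEmbedding.
Variables (R : comNzRingType) (le : R -> R -> Prop) (le_LRR : LRR le).

(** A chosen inverse of [k + 1]; the shift excludes zero and is undone by the predecessor in
    [rat_emb]. *)
Definition nat_inv (k : nat) : R :=
  sval (constructive_indefinite_description _ (LRR_div le_LRR (ltn0Sn k))).

Lemma nat_invP k : nat_inv k *+ k.+1 = 1.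
Proof.
exact: (svalP (constructive_indefinite_description _ (LRR_div le_LRR (ltn0Sn k)))).
Qed.

Definition rat_emb (q : rat) : R :=
  (numq q)%:~R * nat_inv (absz (denq q)).-1.

Lemma rat_embK q : rat_emb q * (denq q)%:~R = (numq q)%:~R.
Proof.
have [k dE] : exists k, denq q = Posz k.+1.
  by case: (denq q) (denq_gt0 q) => // -[|k] // _; exists k.
by rewrite /rat_emb dE /= -mulrA -pmulrn mulr_natr nat_invP mulr1.
Qed.

Lemma denM_inj q (x y : R) : x * (denq q)%:~R = y * (denq q)%:~R -> x = y.
Proof.
have [k ->] : exists k, denq q = Posz k.+1.
  by case: (denq q) (denq_gt0 q) => // -[|k] // _; exists k.
rewrite -!pmulrn => /(congr1 (fun z => z * nat_inv k)).
by rewrite -!mulrA -[_%:R * _]mulrC mulr_natr nat_invP !mulr1.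
Qed.

(** Denominators are invertible in [R], so the equation may be multiplied by all of them; it then
    relates integers and can be checked in [rat]. *)
Lemma rat_emb_is_zmod_morphism : zmod_morphism rat_emb.
Proof.
have regroup (S : comNzRingType) (a b c d e : S) :
    (a - b) * c * d * e = (a * d) * c * e - (b * e) * c * d by ring.
move=> p q; apply: (@denM_inj (p - q)); apply: (@denM_inj p); apply: (@denM_inj q).
rewrite rat_embK regroup !rat_embK -!intrM -intrB; congr (_ %:~R).
by apply: (@intr_inj rat); rewrite !(intrM, intrB) !numqE regroup.
Qed.

Lemma rat_emb_is_monoid_morphism : monoid_morphism rat_emb.
Proof.
split; first by apply: (@denM_inj 1); rewrite rat_embK mul1r.
have regroup (S : comNzRingType) (a b c d e : S) :
    a * b * c * d * e = (a * d) * (b * e) * c by ring.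
move=> p q; apply: (@denM_inj (p * q)); apply: (@denM_inj p); apply: (@denM_inj q).
rewrite rat_embK regroup !rat_embK -!intrM; congr (_ %:~R).
by apply: (@intr_inj rat); rewrite !intrM !numqE regroup.
Qed.

HB.instance Definition _ :=
  GRing.isZmodMorphism.Build rat R rat_emb rat_emb_is_zmod_morphism.
HB.instance Definition _ :=
  GRing.isMonoidMorphism.Build rat R rat_emb rat_emb_is_monoid_morphism.

Lemma LRR_subr x y : le x y <-> le 0 (y - x).
Proof.
split=> [/(LRR_add le_LRR (- x))|/(LRR_add le_LRR x)]; first by rewrite subrr.
by rewrite subrK add0r.
Qed.

Lemma LRR_addr_ge0 x y : le 0 x -> le 0 y -> le 0 (x + y).
Proof.
move=> hx /(LRR_add le_LRR x); rewrite add0r addrC; exact: LRR_trans.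
Qed.

(** Multiplying by the denominator of [c] yields a natural multiple of [x], and [LRR_unperforated]
    then removes the denominator. *)
Lemma LRR_emb_ge0 c x : 0 <= c -> le 0 x -> le 0 (rat_emb c * x).
Proof.
move=> hc hx; apply: (LRR_unperforated le_LRR (k := absz (denq c))).
  by rewrite absz_gt0 denq_eq0.
rewrite -mulr_natr mulrAC [_%:R]pmulrn gtz0_abs ?denq_gt0 // rat_embK.
have : 0 <= numq c by rewrite numq_ge0.
case: (numq c) => // k _; rewrite -pmulrn mulr_natl.
elim: k => [|k IH]; first by rewrite mulr0n; apply: LRR_refl.
by rewrite mulrS; apply: LRR_addr_ge0.
Qed.

Lemma LRR_eq0 x : x = 0 <-> le 0 x /\ le 0 (- x).
Proof.
split=> [->|[h1 h2]]; first by rewrite oppr0; split; apply: LRR_refl.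
by apply: (LRR_antisym le_LRR) => //; apply/LRR_subr; rewrite sub0r.
Qed.

End RationalEmbedding.

(** * Atoms with rational coefficients as polynomials *)

Section PolynomialAtoms.
Variables (n : nat).
Implicit Types (p : {mpoly rat[n]}).

Lemma term_poly_nat k : term_poly (term_nat n k) = k%:R.
Proof. by elim: k => //= k; rewrite /term_poly /= => ->; rewrite mulrS. Qed.

Lemma term_poly_mon (m : 'X_{1..n}) : term_poly (term_mon m) = 'X_[m].
Proof.
rewrite mpolyXE_id -[RHS]big_enum /= /term_mon.
elim: (enum 'I_n) => [|i s IH] /=; first by rewrite big_nil.
rewrite big_cons -IH; elim: (m i) => [|k IHk] /=; first by rewrite expr0 mul1r.
by rewrite /term_poly /= in IHk *; rewrite IHk exprS mulrA.
Qed.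

Lemma term_poly_part p s : term_poly (term_part p s) =
  \sum_(m <- s) (absz (numq ((common_den p)%:~R * p@_m)))%:R *: 'X_[m].
Proof.
rewrite /term_part; elim: s => [|m s IH] /=; first by rewrite big_nil.
rewrite big_cons -IH /term_poly /= -!/(term_poly _); congr (_ + _).
by rewrite term_poly_nat term_poly_mon scaler_nat mulr_natl.
Qed.

Lemma common_den_gt0 p : 0 < common_den p.
Proof. by apply: prodr_gt0 => m _; apply: denq_gt0. Qed.

Lemma common_denM p m : m \in msupp p ->
  (numq ((common_den p)%:~R * p@_m))%:~R = (common_den p)%:~R * p@_m :> rat.
Proof.
move=> mp; rewrite /common_den (big_rem m) //= [denq _ * _]mulrC intrM -mulrA.
by rewrite [(denq _)%:~R * _]mulrC -numqE -intrM numq_int.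
Qed.

(** Clearing denominators scales [p] by a positive integer, which does not affect its sign in a
    model. *)
Lemma term_poly_atom p :
  term_poly (term_pos p) - term_poly (term_neg p) = (common_den p)%:~R *: p.
Proof.
have D0 : 0 < (common_den p)%:~R :> rat by rewrite ltr0z common_den_gt0.
rewrite !term_poly_part -sumrN !big_filter [X in _ *: X](mpolyE p) scaler_sumr.
rewrite [RHS](bigID (fun m => 0 < p@_m)) /=; congr (_ + _).
  rewrite big_seq_cond [RHS]big_seq_cond; apply: eq_bigr => m /andP[mp pm].
  rewrite scalerA pmulrn gez0_abs ?common_denM //.
  by rewrite numq_ge0 mulr_ge0 // ltW.
rewrite big_seq_cond [RHS]big_seq_cond; apply: eq_big => m.
  by rewrite mcoeff_msupp; case: ltgtP.
move=> /andP[mp pm]; rewrite scalerA -scaleNr pmulrn lez0_abs.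
  by rewrite rmorphN /= opprK common_denM.
by rewrite numq_le0 mulr_ge0_le0 // ltW.
Qed.

End PolynomialAtoms.

(** Unlike [literal_polys], this is also available for the atom of a negative literal, whose falsity
    has to be checked in the generic model. *)
Definition atom_polys (n : nat) (a : atom n) := literal_polys (true, a).

(** * The regular cone of a model *)

Section ModelCone.
Variables (n : nat) (R : comNzRingType) (le : R -> R -> Prop) (v : 'I_n -> R).
Hypothesis le_LRR : LRR le.
Implicit Types (p q : {mpoly rat[n]}) (W : {set 'I_n}) (ZP : zp_pair n).

Let ev p : R := mmap (rat_emb le_LRR) v p.

Lemma tval_ev s : Defs.tval v s = ev (term_poly s).
Proof.
rewrite /ev; elim: s => [i|||s IHs u IHu|s IHs u IHu] /=.
- by rewrite /term_poly /= mmapX mmap1U.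
- by rewrite /term_poly /= rmorph0.
- by rewrite /term_poly /= rmorph1.
- by rewrite /term_poly /= rmorphD /= IHs IHu.
- by rewrite /term_poly /= rmorphM /= IHs IHu.
Qed.

Lemma evZ c p : ev (c *: p) = rat_emb le_LRR c * ev p.
Proof. by rewrite -mul_mpolyC /ev rmorphM /= mmapC. Qed.

Lemma ev_ge0Z c p : 0 < c -> le 0 (ev (c *: p)) <-> le 0 (ev p).
Proof.
move=> c0; split=> [h|]; last by rewrite evZ; apply: LRR_emb_ge0; apply: ltW.
rewrite -[p]scale1r -(mulVf (lt0r_neq0 c0)) -scalerA evZ.
by apply: LRR_emb_ge0 => //; rewrite invr_ge0 ltW.
Qed.

Lemma holds_FLe0_ev p : holds le v (FLe0 p) <-> le 0 (ev p).
Proof.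
rewrite /holds /= (LRR_subr le_LRR) !tval_ev -rmorphB /= term_poly_atom.
by apply: ev_ge0Z; rewrite ltr0z common_den_gt0.
Qed.

Lemma atom_holds_polys a :
  atom_holds le v a <-> forall q, q \in atom_polys a -> holds le v (FLe0 q).
Proof.
case: a => s u /=; rewrite !tval_ev.
  rewrite (LRR_subr le_LRR) -rmorphB /= -holds_FLe0_ev.
  split=> [h q|]; first by rewrite inE => /eqP ->.
  by apply; rewrite inE.
have -> : ev (term_poly s) = ev (term_poly u) <->
    ev (term_poly u - term_poly s) = 0.
  rewrite /ev rmorphB /=; split=> [->|/eqP]; first by rewrite subrr.
  by rewrite subr_eq0 => /eqP.
rewrite (LRR_eq0 le_LRR) -rmorphN -!holds_FLe0_ev.
split=> [[h1 h2] q|h]; first by rewrite !inE => /orP[]/eqP ->.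
by split; apply: h; rewrite !inE eqxx ?orbT.
Qed.

Lemma holds_FEq0 p :
  holds le v (FEq0 p) <-> holds le v (FLe0 p) /\ holds le v (FLe0 (- p)).
Proof.
rewrite !holds_FLe0_ev /ev rmorphN -(LRR_eq0 le_LRR) -/(ev p).
rewrite {1}/holds /= !tval_ev.
split=> [h|h].
  apply/(LRR_eq0 le_LRR); rewrite -rmorphN.
  have D0 : 0 < (common_den p)%:~R :> rat by rewrite ltr0z common_den_gt0.
  split; apply/(ev_ge0Z _ D0); rewrite ?scalerN -term_poly_atom ?opprB;
    by rewrite /ev rmorphB /= -!/(ev _) h subrr; apply: LRR_refl.
apply/esym/eqP; rewrite -subr_eq0 -rmorphB /= term_poly_atom -/(ev _) evZ h.
by rewrite mulr0.
Qed.

(** By antisymmetry the additive units are the polynomials that vanish in the model, whence the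
    ideal property. *)
Lemma model_cone_regular W :
  regular_cone W (fun p => poly_over W p /\ holds le v (FLe0 p)).
Proof.
have h0 : poly_over W 0 /\ holds le v (FLe0 0).
  split; first exact: poly_over0.
  by rewrite holds_FLe0_ev /ev rmorph0; apply: LRR_refl.
have hD p q : poly_over W p /\ holds le v (FLe0 p) ->
    poly_over W q /\ holds le v (FLe0 q) ->
    poly_over W (p + q) /\ holds le v (FLe0 (p + q)).
  move=> [pW hp] [qW hq]; split; first exact: poly_overD.
  move: hp hq; rewrite !holds_FLe0_ev /ev rmorphD; exact: LRR_addr_ge0.
split.
- split=> // [p []//|c p hc [pW hp]]; split; first exact: poly_overZ.
  by move: hp; rewrite !holds_FLe0_ev evZ; apply: LRR_emb_ge0.
- split; first exact: poly_over1.
  by rewrite holds_FLe0_ev /ev rmorph1; apply: LRR_le01.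
split=> [p [[]]//||p q [hp hp'] [hq hq']|p q pW [[qW hq] [_ hq']]].
- by rewrite oppr0.
- by rewrite opprD; split; apply: hD.
have q0 : ev q = 0.
  by apply/(LRR_eq0 le_LRR); move: hq hq'; rewrite !holds_FLe0_ev /ev rmorphN.
split; (split; first by rewrite ?poly_overN // poly_overM).
  by rewrite holds_FLe0_ev /ev rmorphM /= -/(ev q) q0 mulr0; apply: LRR_refl.
by rewrite holds_FLe0_ev /ev rmorphN rmorphM /= -/(ev q) q0 mulr0 oppr0; apply: LRR_refl.
Qed.

Lemma model_cone_proper : ~ holds le v (FLe0 (-1)).
Proof.
rewrite holds_FLe0_ev /ev rmorphN rmorph1 => h.
have /eqP := oner_neq0 R; apply; apply/(LRR_eq0 le_LRR); split=> //.
exact: LRR_le01.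
Qed.

Lemma holds_zp_formula W ZP :
  holds le v (zp_formula ZP) <->
  forall p, alg_cone W ZP p -> holds le v (FLe0 p).
Proof.
have foldrP (f : {mpoly rat[n]} -> formula n) s :
    holds le v (foldr (fun z g => FAnd (f z) g) FTrue s) <->
    forall z, z \in s -> holds le v (f z).
  elim: s => [|x s IH] //=.
  split=> [[h1 /IH h2] z|h]; first by rewrite inE => /orP[/eqP ->|/h2].
  split; first by apply: h; rewrite mem_head.
  by apply/IH => z zs; apply: h; rewrite inE zs orbT.
(* The cone is taken in the full polynomial ring, so that its units absorb every multiplier,
   whatever [W] is. *)
have [[_ c0 cD cZ] _ [_ _ iD iM]] := model_cone_regular setT.
split=> [[/foldrP h1 /foldrP h2]|h].
  move=> p hp.
  suff : poly_over setT p /\ holds le v (FLe0 p) by case.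
  move: p hp; apply: alg_cone_ind => //.
    apply: ideal_gen_ind => // p z _ /h1 /holds_FEq0 [hz hz'].
    by case: (iM p z (poly_overT p)) => //; do !split=> //; apply: poly_overT.
  apply: cone_gen_ind => // c p hc /h2 hp.
  by apply: cZ => //; split=> //; apply: poly_overT.
split; apply/foldrP => z hz; last exact/h/alg_cone_cone/cone_gen_mem.
apply/holds_FEq0; split; apply/h/alg_cone_ideal; last apply: ideal_genN;
exact: ideal_gen_mem.
Qed.

End ModelCone.

(** * The model of LRR defined by a proper regular cone *)

Section TermModel.
Variables (n : nat) (C : {mpoly rat[n]} -> Prop).
Hypothesis C_regular : regular_cone setT C.
Hypothesis C_proper : ~ C (-1).

(** The quotient construction asks for a boolean predicate; excluded middle turns the property of
    being an additive unit into one. *)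
Definition unit_ideal : {pred {mpoly rat[n]}} :=
  fun p => if excluded_middle_informative (C p /\ C (- p)) then true else false.

Lemma unit_idealP p : reflect (C p /\ C (- p)) (p \in unit_ideal).
Proof.
rewrite /in_mem /= /unit_ideal; case: excluded_middle_informative => h; exact/(iffP idP).
Qed.

Lemma unit_ideal_closed : idealr_closed unit_ideal.
Proof.
have [[_ c0 cD cZ] c1 [_ i0 iD iM]] := C_regular.
split; first by apply/unit_idealP.
  by apply/negP => /unit_idealP [].
move=> p q r /unit_idealP hq /unit_idealP hr; apply/unit_idealP.
by apply: iD => //; apply: iM => //; apply: poly_overT.
Qed.

HB.instance Definition _ :=
  isIdealr.Build {mpoly rat[n]} unit_ideal unit_ideal_closed.

Let Q : comNzRingType := {ideal_quot unit_ideal}.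
Local Open Scope quotient_scope.

Definition quot_le (x y : Q) : Prop := C (repr y - repr x).

(** The order does not depend on the representatives, since those of a class differ by additive
    units of [C]. *)
Lemma quot_leE p q : quot_le (\pi_Q p) (\pi_Q q) <-> C (q - p).
Proof.
have [[_ c0 cD cZ] c1 [_ i0 iD iM]] := C_regular.
have hrepr r : C (repr (\pi_Q r) - r) /\ C (r - repr (\pi_Q r)).
  have /eqP := reprK (\pi_Q r); rewrite -Quotient.idealrBE => /unit_idealP.
  by rewrite opprB.
rewrite /quot_le; have [hp hp'] := hrepr p; have [hq hq'] := hrepr q.
split=> h.
  have -> : q - p = (q - repr (\pi_Q q)) +
      ((repr (\pi_Q q) - repr (\pi_Q p)) + (repr (\pi_Q p) - p)).
    by rewrite !addrA !subrK.
  by apply: (cD) => //; apply: cD.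
have -> : repr (\pi_Q q) - repr (\pi_Q p) =
    (repr (\pi_Q q) - q) + ((q - p) + (p - repr (\pi_Q p))).
  by rewrite !addrA !subrK.
by apply: (cD) => //; apply: cD.
Qed.

Lemma quot_LRR : LRR quot_le.
Proof.
have [[_ c0 cD cZ] c1 [_ i0 iD iM]] := C_regular.
split.
- by move=> x; rewrite /quot_le subrr.
- move=> x y z; rewrite /quot_le => h1 h2.
  by rewrite -[repr z](subrK (repr y)) -addrA; apply: cD.
- move=> x y h1 h2; rewrite -[x]reprK -[y]reprK; apply/eqP.
  by rewrite -Quotient.idealrBE; apply/unit_idealP; rewrite opprB.
- move=> x y z; rewrite -[x]reprK -[y]reprK -[z]reprK -!rmorphD !quot_leE.
  by rewrite opprD addrACA subrr addr0.
- by rewrite -(rmorph0 \pi_Q) -(rmorph1 \pi_Q) quot_leE subr0.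
- case=> // k _; exists (\pi_Q (k.+1%:R^-1)%:MP).
  rewrite -rmorphMn -mpolyCMn /= -[_ *+ _]mulr_natr mulVf ?pnatr_eq0 //.
  by rewrite mpolyC1 rmorph1.
case=> // k _ x; rewrite -[x]reprK -rmorphMn -(rmorph0 \pi_Q) !quot_leE !subr0.
move=> /(cZ (k.+1%:R^-1)); rewrite -scaler_nat scalerA mulVf ?pnatr_eq0 // scale1r.
by apply; rewrite invr_ge0 ler0n.
Qed.

Lemma term_model : exists (R : comNzRingType) (le : R -> R -> Prop)
    (v : 'I_n -> R), LRR le /\ forall p, holds le v (FLe0 p) <-> C p.
Proof.
exists Q, quot_le, (fun i => \pi_Q 'X_i); split; first exact: quot_LRR.
have tvalE s : Defs.tval (fun i => \pi_Q 'X_i) s = \pi_Q (term_poly s) :> Q.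
  elim: s => [i|||s IHs u IHu|s IHs u IHu] //=.
  - by rewrite rmorph0.
  - by rewrite rmorph1.
  - by rewrite IHs IHu -rmorphD.
  - by rewrite IHs IHu -rmorphM.
move=> p; rewrite /holds /= !tvalE quot_leE term_poly_atom.
have [[_ c0 cD cZ] c1 _] := C_regular.
have D0 : 0 < (common_den p)%:~R :> rat by rewrite ltr0z common_den_gt0.
split=> [/(cZ (common_den p)%:~R^-1)|]; last exact/cZ/ltW.
by rewrite scalerA mulVf ?lt0r_neq0 // scale1r; apply; rewrite invr_ge0 ltW.
Qed.

End TermModel.

(** * Least regular cones in Q[Y] *)

Section RegularCones.
Variables (n : nat) (Y : {set 'I_n}).
Implicit Types (p q : {mpoly rat[n]}) (C : {mpoly rat[n]} -> Prop).

(** A retraction onto Q[Y]. Pulling a regular cone of Q[Y] back along it gives one of the full ring,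
    where the quotient model is built. *)
Definition restrict_vars : {mpoly rat[n]} -> {mpoly rat[n]} :=
  psubst (fun i => if i \in Y then 'X_i else 0).

Lemma restrict_vars_over p : poly_over Y (restrict_vars p).
Proof.
apply: psubst_over (poly_overT p) => i _; case: ifP => [iY|_].
  exact: poly_overXU.
exact: poly_over0.
Qed.

Lemma restrict_vars_id p : poly_over Y p -> restrict_vars p = p.
Proof. by apply: psubst_id => i ->. Qed.

Lemma regular_cone_lift C : regular_cone Y C ->
  regular_cone setT (fun p => C (restrict_vars p)).
Proof.
move=> [[_ c0 cD cZ] c1 [_ i0 iD iM]]; split.
- split=> [p _|||].
  + exact: poly_overT.
  + by rewrite /restrict_vars /psubst rmorph0.
  + by move=> p q hp hq; rewrite /restrict_vars /psubst rmorphD; apply: cD.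
  + by move=> c p hc hp; rewrite /restrict_vars psubstZ; apply: cZ.
- by rewrite restrict_vars_id ?poly_over1.
have restrictN p : restrict_vars (- p) = - restrict_vars p.
  by rewrite /restrict_vars /psubst rmorphN.
split=> [p _|||].
- exact: poly_overT.
- by rewrite oppr0 /restrict_vars /psubst rmorph0; split.
- move=> p q; rewrite !restrictN => hp hq.
  by rewrite /restrict_vars /psubst rmorphD; apply: (iD).
move=> p q _; rewrite !restrictN => hq.
rewrite /restrict_vars /psubst rmorphM; apply: (iM) => //.
exact: restrict_vars_over.
Qed.

Lemma regular_cone_alg_cone C (ZP : zp_pair n) : regular_cone Y C ->
  (forall z, z \in ZP.1 -> C z /\ C (- z)) -> (forall p, p \in ZP.2 -> C p) ->
  forall p, alg_cone Y ZP p -> C p.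
Proof.
move=> [[_ c0 cD cZ] c1 [_ i0 iD iM]] h1 h2; apply: alg_cone_ind => //.
  apply: ideal_gen_ind => // p z pY /h1 hz.
  by case: (iM p z pY hz).
by apply: cone_gen_ind => // c p hc /h2; apply: cZ.
Qed.

(* The generators of C whose opposite lies in C generate the ideal of its
   additive units: if p and -p are both in <Z> + cone(P), every element of P
   with a positive weight in p has its opposite in <Z> + cone(P). *)
Lemma least_regular_cone_exists (S : seq {mpoly rat[n]}) :
  (forall p, p \in S -> poly_over Y p) ->
  exists ZP : zp_pair n, [/\ forall z, z \in ZP.1 -> poly_over Y z,
    forall p, p \in ZP.2 -> poly_over Y p
    & least_regular_cone Y S (alg_cone Y ZP)].
Proof.
(* [C] is the intersection of all regular cones containing [S]. It selects the generators that go
   into [Z]; the number 1 joins [P] because every regular cone contains it. *)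
move=> SY; pose C p := forall C', regular_cone Y C' ->
  (forall q, q \in S -> C' q) -> C' p.
pose P := 1 :: S.
pose Z := [seq p <- P | if excluded_middle_informative (C (- p)) then true else false].
have ZP z : z \in Z -> z \in P /\ C (- z).
  by rewrite mem_filter; case: excluded_middle_informative.
have PZ z : z \in P -> C (- z) -> z \in Z.
  by rewrite mem_filter => ->; case: excluded_middle_informative.
have PC C' : regular_cone Y C' -> (forall q, q \in S -> C' q) ->
    forall p, p \in P -> C' p.
  by move=> [_ c1 _] hS p; rewrite inE => /orP[/eqP ->|/hS].
have PY p : p \in P -> poly_over Y p.
  by rewrite inE => /orP[/eqP ->|/SY //]; apply: poly_over1.
have ZY p : p \in Z -> poly_over Y p by case/ZP => /PY.
have sub p : alg_cone Y (Z, P) p -> C p.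
  move=> hp C' rC' hS; apply: regular_cone_alg_cone hp => //= q.
    move=> /ZP [qP hq]; split; first exact: PC qP.
    exact: hq.
  exact: PC.
have unitsP p : alg_cone Y (Z, P) p /\ alg_cone Y (Z, P) (- p) <-> ideal_gen Y Z p.
  split; last by move=> h; split; apply: alg_cone_ideal; rewrite //; apply: ideal_genN.
  move=> [[a [b [/= ha [c [hc bE]] ->]]] [a' [b' [/= ha' hb' pE]]]].
  apply: ideal_genD => //; rewrite bE; apply: (big_ind (ideal_gen Y Z)).
  - exact: ideal_gen0.
  - exact: ideal_genD.
  move=> i _; have [->|ci] := eqVneq (c i) 0.
    by rewrite scale0r; apply: ideal_gen0.
  apply/ideal_genZ/ideal_gen_mem/PZ; first exact: mem_nth.
  have ci_gt0 : 0 < c i by rewrite lt_def ci hc.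
  (* The equation [- (a + b) = a' + b'] is solved for the generator of index [i]. *)
  have -> : - P`_i = (c i)^-1 *: (a + a' + (b' + \sum_(j < size P | j != i) c j *: P`_j)).
    rewrite -[LHS]scale1r -(mulVf ci) -scalerA; congr (_ *: _).
    move: pE; rewrite bE (bigD1 i) //= => pE.
    rewrite scalerN -addrA [a' + _]addrA -pE.
    rewrite !opprD; set x := c i *: _; set y := \sum_(j < _ | _) _.
    by rewrite -!addrA addNr addr0 addrA subrr add0r.
  apply: sub; apply: alg_coneZ; first by rewrite invr_ge0.
  apply: alg_coneD; first exact/alg_cone_ideal/ideal_genD.
  apply/alg_cone_cone/cone_genD => //.
  apply: (big_ind (cone_gen P)); [exact: cone_gen0|exact: cone_genD|move=> j _].
  by apply: cone_genZ => //; apply/cone_gen_mem/mem_nth.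
exists (Z, P); split=> //; split=> [|p pS|C' rC' hS p /sub]; last exact.
  split; first split.
  - exact: alg_cone_over.
  - exact/alg_cone_ideal/ideal_gen0.
  - exact: alg_coneD.
  - exact: alg_coneZ.
  - by apply/alg_cone_cone/cone_gen_mem; rewrite mem_head.
  split=> [p [hp _]|||].
  - exact: alg_cone_over hp.
  - by apply/unitsP; apply: ideal_gen0.
  - by move=> p q /unitsP hp /unitsP hq; apply/unitsP/ideal_genD.
  - by move=> p q hp /unitsP hq; apply/unitsP/ideal_genM.
by apply/alg_cone_cone/cone_gen_mem; rewrite inE pS orbT.
Qed.

Lemma least_regular_cone_ext S C C' : (forall p, C' p <-> C p) ->
  least_regular_cone Y S C -> least_regular_cone Y S C'.
Proof.
move=> E [[[h1 h2 h3 h4] h5 [i1 i2 i3 i4]] h6 h7].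
split; [split|by move=> p /h6 /E|by move=> D hD hS p /E; apply: h7].
- split; first by move=> p /E /h1.
  + exact/E.
  + by move=> p q /E hp /E hq; apply/E/h3.
  + by move=> c p hc /E hp; apply/E/h4.
- exact/E.
split; first by move=> p [/E /h1].
- by split; apply/E; case: i2.
- by move=> p q [/E h /E h'] [/E k /E k']; rewrite !E; apply: i3.
- by move=> p q hp [/E h /E h']; rewrite !E; apply: i4.
Qed.

End RegularCones.

(** * Disjunctive normal forms and generic models of cubes *)

Section Cubes.
Variable n : nat.
Implicit Types (f g : formula n) (c : cube n) (l : literal n).

Lemma In_cat (T : Type) (x : T) s1 s2 :
  List.In x (s1 ++ s2) <-> List.In x s1 \/ List.In x s2.
Proof. by elim: s1 => [|y s IH] /=; [tauto|rewrite IH; tauto]. Qed.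

Lemma cube_formulaP (h : atom n -> Prop) c :
  prop_eval h (cube_formula c) <->
  forall l, List.In l c -> prop_eval h (literal_formula l).
Proof.
elim: c => [|x c IH] //=; rewrite IH.
split=> [[h1 h2] l [<-//|/h2 //]|H].
by split=> [|l hl]; apply: H; tauto.
Qed.

Lemma mem_cube_polys c q :
  q \in cube_polys c <-> exists2 l, List.In l c & q \in literal_polys l.
Proof.
elim: c => [|x c IH]; first by split=> [//|[]].
rewrite /cube_polys /= mem_cat -/(cube_polys c); split.
  case/orP => [hq|/IH [l hl hq]]; first by exists x => //; left.
  by exists l => //; right.
move=> [l [->->//|hl] hq]; apply/orP; right; apply/IH; by exists l.
Qed.

(** The induction treats a formula and its negation together, so that negation only flips [b].
    Conjunctions pair the cubes of both sides, disjunctions collect them, and De Morgan's laws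
    exchange the two cases. *)
Lemma dnf_exists f : exists D, is_dnf D f.
Proof.
suff main b : exists D : seq (cube n),
    (forall c l, List.In c D -> List.In l c -> List.In l (nnf_literals b f)) /\
    (forall h, (if b then prop_eval h f else ~ prop_eval h f) <->
       exists c, List.In c D /\ prop_eval h (cube_formula c)).
  by have [D hD] := main true; exists D.
have conjP (ls1 ls2 : seq (literal n)) D1 D2 (H1 H2 H : (atom n -> Prop) -> Prop) :
    (forall h, H h <-> H1 h /\ H2 h) ->
    (forall c l, List.In c D1 -> List.In l c -> List.In l ls1) /\
    (forall h, H1 h <-> exists c, List.In c D1 /\ prop_eval h (cube_formula c)) ->
    (forall c l, List.In c D2 -> List.In l c -> List.In l ls2) /\
    (forall h, H2 h <-> exists c, List.In c D2 /\ prop_eval h (cube_formula c)) ->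
    exists D : seq (cube n),
    (forall c l, List.In c D -> List.In l c -> List.In l (ls1 ++ ls2)) /\
    (forall h, H h <-> exists c, List.In c D /\ prop_eval h (cube_formula c)).
  move=> HE [a1 b1] [a2 b2].
  exists (List.map (fun x => x.1 ++ x.2) (List.list_prod D1 D2)); split.
    move=> c l /List.in_map_iff [[c1 c2] [<- /List.in_prod_iff [h1 h2]]] /In_cat hl.
    by apply/In_cat; case: hl => hl; [left; apply: a1 hl|right; apply: a2 hl].
  move=> h; rewrite HE b1 b2; split.
    move=> [[c1 [h1 k1]] [c2 [h2 k2]]]; exists (c1 ++ c2); split.
      by apply/List.in_map_iff; exists (c1, c2); split=> //; apply/List.in_prod_iff.
    apply/cube_formulaP => l /In_cat.
    by case=> hl; [apply: (proj1 (cube_formulaP _ _) k1)|apply: (proj1 (cube_formulaP _ _) k2)].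
  move=> [c [/List.in_map_iff [[c1 c2] [<- /List.in_prod_iff [h1 h2]]] /cube_formulaP k]].
  split; [exists c1|exists c2]; split=> //; apply/cube_formulaP => l hl; apply: k;
    by apply/In_cat; tauto.
have disjP (ls1 ls2 : seq (literal n)) D1 D2 (H1 H2 H : (atom n -> Prop) -> Prop) :
    (forall h, H h <-> H1 h \/ H2 h) ->
    (forall c l, List.In c D1 -> List.In l c -> List.In l ls1) /\
    (forall h, H1 h <-> exists c, List.In c D1 /\ prop_eval h (cube_formula c)) ->
    (forall c l, List.In c D2 -> List.In l c -> List.In l ls2) /\
    (forall h, H2 h <-> exists c, List.In c D2 /\ prop_eval h (cube_formula c)) ->
    exists D : seq (cube n),
    (forall c l, List.In c D -> List.In l c -> List.In l (ls1 ++ ls2)) /\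
    (forall h, H h <-> exists c, List.In c D /\ prop_eval h (cube_formula c)).
  move=> HE [a1 b1] [a2 b2]; exists (D1 ++ D2); split.
    move=> c l /In_cat hc hl; apply/In_cat.
    by case: hc => hc; [left; apply: a1 hl|right; apply: a2 hl].
  move=> h; rewrite HE b1 b2; split.
    by case=> -[c [hc k]]; exists c; split=> //; apply/In_cat; tauto.
  by move=> [c [/In_cat [hc|hc] k]]; [left|right]; exists c.
elim: f b => [|a|f IHf|f IHf g IHg|f IHf g IHg] b /=.
- case: b; [exists [:: [::]]|exists [::]]; split=> //=.
  + by move=> c l [<-|].
  + by move=> h; split=> // _; exists [::]; split=> //; left.
  by move=> h; split=> [hn|[c [hc _]]]; [case: hn|case: hc].
- exists [:: [:: (b, a)]]; split; first by move=> c l /= [<-|].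
  move=> h; split=> [hb|[c [[<-|//] /= [hb _]]]]; last by case: b hb.
  by exists [:: (b, a)]; split; [left|case: b hb].
- have [D [h1 h2]] := IHf (~~ b); exists D; split=> // h; rewrite -h2.
  by case: b {h1 h2} => //=; split=> [/NNPP//|hp hn]; apply: hn.
- have [D1 hD1] := IHf b; have [D2 hD2] := IHg b; case: b hD1 hD2 => hD1 hD2.
    exact: conjP hD1 hD2.
  by apply: disjP hD1 hD2 => h; split=> [/not_and_or|[]]; tauto.
have [D1 hD1] := IHf b; have [D2 hD2] := IHg b; case: b hD1 hD2 => hD1 hD2.
  exact: disjP hD1 hD2.
by apply: conjP hD1 hD2 => h; split=> [/not_or_and|]; tauto.
Qed.

Lemma literal_polysP l q : q \in literal_polys l -> l.1 /\ q \in atom_polys l.2.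
Proof. by case: l => -[] a. Qed.

Lemma cube_polys_hold (R : comNzRingType) (le : R -> R -> Prop) (v : 'I_n -> R) c :
  LRR le -> holds le v (cube_formula c) ->
  forall q, q \in cube_polys c -> holds le v (FLe0 q).
Proof.
move=> le_LRR /cube_formulaP hc q /mem_cube_polys [l lc /[dup] /literal_polysP [l1 _]].
case: l lc l1 => -[] // a /hc /= ha _ hq.
exact: (proj1 (atom_holds_polys v le_LRR a) ha).
Qed.

(** The polynomials over [Y] that are non-negative in the model form one of the regular cones
    containing [S], so they include the least one. *)
Lemma lrc_holds (Y : {set 'I_n}) S C (R : comNzRingType) (le : R -> R -> Prop)
    (v : 'I_n -> R) : LRR le -> least_regular_cone Y S C ->
  (forall q, q \in S -> holds le v (FLe0 q)) ->
  forall p, C p -> holds le v (FLe0 p).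
Proof.
move=> le_LRR [[[CY _ _ _] _ _] CS Cmin] hS p Cp.
have [|_ //] := Cmin _ (model_cone_regular v le_LRR Y) _ p Cp.
by move=> q qS; split; [apply/CY/CS|apply: hS].
Qed.

(* The generic model Q[Y]/(C :&: -C): the cube's negated atoms hold in it since
   C is below the cone of any model of the cube. *)
Lemma cube_generic_model (Y : {set 'I_n}) c C :
  satisfiable (cube_formula c) ->
  (forall l q, List.In l c -> q \in atom_polys l.2 -> poly_over Y q) ->
  least_regular_cone Y (cube_polys c) C ->
  exists (R : comNzRingType) (le : R -> R -> Prop) (v : 'I_n -> R),
    [/\ LRR le, holds le v (cube_formula c)
      & forall p, poly_over Y p -> holds le v (FLe0 p) -> C p].
Proof.
move=> [R0 [le0 [v0 [LRR0 hc0]]]] cY lrc.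
have C0 p : C p -> holds le0 v0 (FLe0 p).
  by apply: (lrc_holds LRR0 lrc) => q; apply: cube_polys_hold.
have [Creg CS _] := lrc.
(* The cone is proper because it lies below the cone of the given model of the cube, which does not
   contain -1. *)
have [||R [le [v [le_LRR hv]]]] := @term_model n (fun p => C (restrict_vars Y p)).
- exact: regular_cone_lift.
- rewrite restrict_vars_id; last exact/poly_overN/poly_over1.
  by move=> /C0; apply: model_cone_proper.
exists R, le, v; split=> //; last first.
  by move=> p pY /hv; rewrite restrict_vars_id.
apply/cube_formulaP => -[b a] lc; case: b lc => lc /=.
  apply/(atom_holds_polys v le_LRR) => q hq; apply/hv.
  rewrite restrict_vars_id; last exact: cY lc hq.
  by apply/CS/mem_cube_polys; exists (true, a).
move=> /(atom_holds_polys v le_LRR) ha.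
have /= := proj1 (cube_formulaP _ _) hc0 _ lc; apply.
apply/(atom_holds_polys v0 LRR0) => q hq; apply: C0.
by have /hv := ha q hq; rewrite restrict_vars_id //; apply: cY lc hq.
Qed.

Lemma term_poly_over (Y : {set 'I_n}) s :
  {subset tconsts s <= Y} -> poly_over Y (term_poly s).
Proof.
rewrite /term_poly; elim: s => [i|||s IHs u IHu|s IHs u IHu] /= h.
- by apply: poly_overXU; apply: h; rewrite mem_head.
- exact: poly_over0.
- exact: poly_over1.
- by apply: poly_overD; [apply: IHs|apply: IHu] => i hi; apply: h; rewrite mem_cat hi ?orbT.
- by apply: poly_overM; [apply: IHs|apply: IHu] => i hi; apply: h; rewrite mem_cat hi ?orbT.
Qed.

Lemma nnf_literals_over (Y : {set 'I_n}) b f l q :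
  formula_over Y f -> List.In l (nnf_literals b f) ->
  q \in atom_polys l.2 -> poly_over Y q.
Proof.
rewrite /formula_over; elim: f b => [|a|f IHf|f IHf g IHg|f IHf g IHg] b //=.
- move=> h [<-|//] /=; case: a h => s u /= h.
    rewrite inE => /eqP ->.
    by apply: poly_overB; apply: term_poly_over => i hi; apply: h; rewrite mem_cat hi ?orbT.
  have hsu : poly_over Y (term_poly u - term_poly s).
    by apply: poly_overB; apply: term_poly_over => i hi; apply: h; rewrite mem_cat hi ?orbT.
  by rewrite !inE => /orP[]/eqP -> //; apply: poly_overN.
- exact: IHf.
- move=> h /In_cat [hl|hl] hq; [apply: IHf hl hq|apply: IHg hl hq] => i hi;
  by apply: h; rewrite mem_cat hi ?orbT.
- move=> h /In_cat [hl|hl] hq; [apply: IHf hl hq|apply: IHg hl hq] => i hi;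
  by apply: h; rewrite mem_cat hi ?orbT.
Qed.

Lemma nnf_literals_zp (X : {set 'I_n}) (ZP : zp_pair n) l :
  zp_over X ZP -> List.In l (nnf_literals false (zp_formula ZP)) ->
  l.1 = false /\ forall q, q \in atom_polys l.2 -> poly_over X q.
Proof.
move=> [h1 h2] /= /In_cat [].
  elim: (ZP.1) h1 => //= z s IH h1 [<-|]; last first.
    by apply: IH => y ys; apply: h1; rewrite inE ys orbT.
  split=> // q; rewrite /= !inE term_poly_atom => /orP[]/eqP ->;
    rewrite ?poly_overN // poly_overZ // h1 // mem_head //.
elim: (ZP.2) h2 => //= z s IH h2 [<-|]; last first.
  by apply: IH => y ys; apply: h2; rewrite inE ys orbT.
split=> // q; rewrite /= !inE term_poly_atom => /eqP ->.
by rewrite poly_overZ // h2 // mem_head.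
Qed.

End Cubes.

(** * The consequence procedure *)

Section Consequence.
Variables (n : nat) (le : rel 'X_{1..n}) (Y X : {set 'I_n}) (t : 'I_n).
Variable F : formula n.
Hypotheses (le_mo : monomial_order le) (X_sub_Y : X \subset Y).
Hypotheses (t_fresh : t \notin Y) (F_over_Y : formula_over Y F).
Implicit Types (G : formula n) (ZP : zp_pair n).

Let t_freshX : t \notin X.
Proof. by apply: contra t_fresh => /(subsetP X_sub_Y). Qed.

(** In [inv_sound], a model of [F] either is still to be covered or already satisfies the current
    cone; once [G] is unsatisfiable only the second case remains. [inv_pos] is there for
    termination, and [inv_over] keeps the atoms of every cube within Q[Y]. *)
Record loop_inv G ZP : Prop := LoopInv {
  inv_pos : forall a, List.In (true, a) (nnf_literals true G) ->
    List.In (true, a) (nnf_literals true F);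
  inv_over : forall l q, List.In l (nnf_literals true G) ->
    q \in atom_polys l.2 -> poly_over Y q;
  inv_entails : entails G F;
  inv_reduced : reduced le X ZP;
  inv_zp_over : zp_over X ZP;
  inv_complete : forall p, Cn X F p -> alg_cone X ZP p;
  inv_sound : forall (R : comNzRingType) (leR : R -> R -> Prop) (v : 'I_n -> R),
    LRR leR -> holds leR v F ->
    holds leR v G \/ forall p, alg_cone X ZP p -> holds leR v (FLe0 p)
}.

Definition model_inv G ZP : Prop := zp_over Y ZP /\
  exists c : cube n,
    [/\ forall l, List.In l c -> List.In l (nnf_literals true G),
        entails (cube_formula c) G, satisfiable (cube_formula c)
      & least_regular_cone Y (cube_polys c) (alg_cone Y ZP)].

(** The pair before projection is remembered, because completeness and termination both argue on its
    cube. *)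
Definition proj_inv G ZP : Prop := zp_over X ZP /\
  exists2 ZP', model_inv G ZP' &
    forall p, alg_cone X ZP p <-> alg_cone Y ZP' p /\ poly_over X p.

Definition config_inv (c : config n) : Prop :=
  match c with
  | AtTest G ZP => loop_inv G ZP
  | AtProject G ZP ZP' => loop_inv G ZP /\ model_inv G ZP'
  | AtIntersect G ZP ZP' => loop_inv G ZP /\ proj_inv G ZP'
  | Returned ZP => reduced le X ZP /\ forall p, alg_cone X ZP p <-> Cn X F p
  end.

(** The initial pair generates all of Q[X], the neutral element for intersection. *)
Lemma initial_inv : config_inv (initial F).
Proof.
have over1 : zp_over X ([:: 1], [:: 0]).
  by split=> p; rewrite inE => /eqP ->; [apply: poly_over1|apply: poly_over0].
split=> //.
- by move=> l q; apply: nnf_literals_over.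
- split=> [|p /=]; last first.
    rewrite inE => /eqP ->; split; first by rewrite subrr; apply: ideal_gen0.
    by move=> m g m'; rewrite -mpolyC0 msupp0.
  split=> // p m _ [mp _]; exists 1, 0%MM; split; first by rewrite mem_head.
    by split=> [|m']; rewrite -mpolyC1 msupp1 inE // => /eqP ->; apply: mo_refl.
  by apply/mnm_lepP => i; rewrite mnm0E.
- move=> p [pX _]; apply: alg_cone_ideal; rewrite -[p]mulr1.
  by apply: ideal_genM => //; apply: ideal_gen_mem; rewrite mem_head.
- by move=> R leR v _ hF; left.
Qed.

Lemma get_model_inv G ZP' : get_model le Y G ZP' -> model_inv G ZP'.
Proof.
move=> [D [c [[hD1 hD2] cD csat _ lrc]]]; have [[[CY _ _ _] _ _] _ _] := lrc.
split.
  split=> p hp; apply: CY; first exact/alg_cone_ideal/ideal_gen_mem.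
  exact/alg_cone_cone/cone_gen_mem.
exists c; split=> // [l|R leR v _ hc]; first exact: hD1 cD.
by apply/hD2; exists c.
Qed.

(** The generic model of the cube satisfies [G], hence [F], hence [0 <= p]; what is non-negative
    there and lies in Q[Y] belongs to the cone. *)
Lemma Cn_model_inv G ZP ZP' p : loop_inv G ZP -> model_inv G ZP' ->
  Cn X F p -> alg_cone Y ZP' p.
Proof.
move=> inv [_ [c [cG ent csat lrc]]] [pX hp].
have [l q lc hq|R [leR [v [leR_LRR hc hC]]]] := cube_generic_model csat _ lrc.
  exact: (inv_over inv) (cG l lc) hq.
apply: hC; first exact: poly_overS pX.
exact: hp (inv_entails inv leR_LRR (ent _ _ _ leR_LRR hc)).
Qed.

Lemma config_inv_step c c' : step le Y X t c c' -> config_inv c -> config_inv c'.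
Proof.
case=> [G ZP ZP' _ /get_model_inv|G ZP ZP' ZP'' prj [inv mod]
       |G ZP ZP' ZP'' hint [inv [oX' [ZPm mod hm]]]|G ZP unsat inv] //=.
- split=> //; have [oY _] := mod; split; first exact: project_over prj.
  by exists ZP' => //; apply: project_cone prj.
- have oX := inv_zp_over inv.
  have [red oX''] := intersect_reduced le_mo oX oX' hint.
  have hcone := intersect_cone le_mo t_freshX oX oX' hint.
  split=> //.
  + move=> a /= /In_cat [/(inv_pos inv)//|/(nnf_literals_zp oX'') []//].
  + move=> l q /= /In_cat [hl|/(nnf_literals_zp oX'') [_ hl]] hq.
      exact: (inv_over inv) hl hq.
    by apply: poly_overS X_sub_Y _; apply: hl.
  + by move=> R leR v hR [hG _]; apply: (inv_entails inv).
  + move=> p hp; apply/hcone; split; first exact: (inv_complete inv).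
    by apply/hm; split; [apply: Cn_model_inv inv mod hp|case: hp].
  move=> R leR v leR_LRR hF.
  (* A model satisfying the old cone satisfies the smaller new one. A model of [G] either refutes
     the new conjunction, and so satisfies the new formula, or satisfies the whole new cone. *)
  have [hG|hZP] := inv_sound inv leR_LRR hF; last first.
    by right=> p /hcone [/hZP].
  have [hz|hz] := classic (holds leR v (zp_formula ZP'')); last by left; split.
  by right; apply/(holds_zp_formula v leR_LRR).
split; first exact: inv_reduced inv.
move=> p; split=> [hp|]; last exact: (inv_complete inv).
split.
  by have [h1 h2] := inv_zp_over inv; apply: alg_cone_over hp.
move=> R leR v leR_LRR hF.
have [hG|] := inv_sound inv leR_LRR hF; last exact.
by case: unsat; exists R, leR, v.
Qed.

(** The sub-procedures are relations, so the point is that each has some result on the arguments the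
    invariant allows. *)
Lemma config_inv_progress c : config_inv c ->
  (exists c', step le Y X t c c') \/ (exists ZP, c = Returned ZP).
Proof.
case: c => [G ZP inv|G ZP ZP' [inv [oY _]]|G ZP ZP' [inv [oX' _]]|ZP _] /=;
  [left|left|left|by right; exists ZP].
- have [sat|unsat] := classic (satisfiable G); last first.
    by exists (Returned ZP); apply: step_return.
  have [D hD] := dnf_exists G; have [hD1 hD2] := hD.
  have [R [leR [v [leR_LRR /hD2 [c [cD hc]]]]]] := sat.
  have [p /mem_cube_polys [l lc /literal_polysP [_ hp]]|ZP0 [h1 h2 lrc]] :=
    @least_regular_cone_exists n Y (cube_polys c).
    exact: (inv_over inv) (hD1 c l cD lc) hp.
  have [ZP' red hZP'] := reduce_exists le_mo h1 h2.
  exists (AtProject G ZP ZP'); apply: step_get_model => //.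
  exists D, c; split=> //; first by exists R, leR, v.
  by apply: least_regular_cone_ext lrc => p; rewrite hZP'; case: (ZP0).
- have [ZP'' hZP''] := project_exists le_mo X oY.
  by exists (AtIntersect G ZP ZP''); apply: step_project.
- have [ZP'' hZP''] := intersect_exists le_mo t (inv_zp_over inv) oX'.
  by eexists; apply: step_intersect hZP''.
Qed.

Let PF := cube_polys (nnf_literals true F).

(** [A] selects among the polynomials of the positive atoms of [F]. The number of alive sets is the
    termination measure. *)
Definition alive G (A : {set 'I_(size PF)}) : Prop :=
  exists (R : comNzRingType) (leR : R -> R -> Prop) (v : 'I_n -> R),
    [/\ LRR leR, holds leR v G & forall i, i \in A -> holds leR v (FLe0 PF`_i)].

Definition alive_set G : {set {set 'I_(size PF)}} :=
  [set A | if excluded_middle_informative (alive G A) then true else false].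

Lemma alive_setP G A : reflect (alive G A) (A \in alive_set G).
Proof. by rewrite inE; case: excluded_middle_informative => h; apply: (iffP idP). Qed.

(** Strengthening [G] creates no alive set. The set [A] given by the chosen cube was alive, as the
    cube is satisfiable; it dies because a model satisfying its polynomials satisfies their least
    regular cone, hence the conjunction just negated. *)
Lemma alive_set_decr G ZP ZP' ZP'' : loop_inv G ZP -> proj_inv G ZP' ->
  (forall p, alg_cone X ZP'' p -> alg_cone X ZP' p) ->
  (#|alive_set (FAnd G (FNot (zp_formula ZP'')))| < #|alive_set G|)%N.
Proof.
move=> inv [_ [ZPm [_ [c [cG ent csat lrc]]] hm]] sub.
pose A : {set 'I_(size PF)} := [set i : 'I_(size PF) | PF`_i \in cube_polys c].
apply/proper_card/properP; split.
  apply/subsetP => B /alive_setP [R [leR [v [h1 [h2 _] h3]]]].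
  by apply/alive_setP; exists R, leR, v.
exists A.
  have [R [leR [v [leR_LRR hc]]]] := csat.
  apply/alive_setP; exists R, leR, v; split=> //; first exact: ent.
  by move=> i; rewrite inE; apply: cube_polys_hold.
apply/negP => /alive_setP [R [leR [v [leR_LRR [_ hz] hA]]]]; apply: hz.
apply/(holds_zp_formula v leR_LRR X ZP'') => p /sub /hm [hp _].
apply: (lrc_holds leR_LRR lrc _ hp) => q qc.
(* Positive literals of the cube come from [F], so [A] accounts for every polynomial of the cube. *)
have qF : q \in PF.
  have /mem_cube_polys [[b a] lc hq] := qc; have [/= b1 _] := literal_polysP hq.
  rewrite b1 in lc hq; apply/mem_cube_polys; exists (true, a) => //.
  exact/(inv_pos inv)/cG.
have lt_q : (index q PF < size PF)%N by rewrite index_mem.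
have /= := hA (Ordinal lt_q); rewrite nth_index //; apply.
by rewrite inE /= nth_index.
Qed.

(** An iteration takes three steps, and the measure is compared only from one loop test to the
    next. *)
Lemma loop_terminates G ZP : loop_inv G ZP ->
  Acc (fun c' c => step le Y X t c c') (AtTest G ZP).
Proof.
move: {2}(#|_|).+1 (ltnSn #|alive_set G|) => k.
elim: k G ZP => [|k IH] G ZP le_k inv; first by rewrite ltn0 in le_k.
split=> c1 s1; have inv1 := config_inv_step s1 inv.
inversion s1 as [? ? ZP1 _ _ eG e1| | |]; subst; last by split=> c2 s2; inversion s2.
split=> c2 s2; have inv2 := config_inv_step s2 inv1.
inversion s2 as [|? ? ? ZP2 _ eG e2| |]; subst.
split=> c3 s3; have inv3 := config_inv_step s3 inv2.
inversion s3 as [| |? ? ? ZP3 hint eG e3|]; subst.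
apply: IH inv3; rewrite ltnS in le_k; apply: leq_trans le_k.
have [_ prj] := inv2; have [oX' _] := prj.
apply: (alive_set_decr inv prj) => p.
by move/(intersect_cone le_mo t_freshX (inv_zp_over inv) oX' hint) => [].
Qed.

Lemma reachable_inv c : reachable le Y X t F c -> config_inv c.
Proof.
rewrite /reachable => h; elim: h initial_inv => //.
  by move=> c1 c2; apply: config_inv_step.
by move=> c1 c2 c3 _ h1 _ h2 /h1.
Qed.

End Consequence.

Theorem theorem3p12 (n : nat) (le : rel 'X_{1..n}) (Y X : {set 'I_n}) (t : 'I_n)
    (F : formula n)
    (le_monomial_order : monomial_order le)
    (X_sub_Y : X \subset Y)
    (t_fresh : t \notin Y)
    (F_over_Y : formula_over Y F) :
  consequence_terminates le Y X t F /\
  (forall ZP : zp_pair n, consequence_returns le Y X t F ZP ->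
     reduced le X ZP /\
     (forall p : {mpoly rat[n]}, alg_cone X ZP p <-> Cn X F p)).
Proof.
have inv := reachable_inv le_monomial_order X_sub_Y t_fresh F_over_Y.
split=> [|ZP /inv //]; split=> [|c /inv]; last exact: config_inv_progress.
have inv0 := initial_inv X le_monomial_order F_over_Y.
exact: (loop_terminates le_monomial_order X_sub_Y t_fresh inv0).
Qed.
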